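(* For every $\omega\in\{\mathbf{0},\mathbf{1},\mathbf{2}\}^{\mathbb{N}_+}$, the Grigorchuk group $G_\omega$ can be embedded in a finitely generated simple group that has trivial Poisson--Furstenberg boundary for every symmetric, finitely supported probability measure on it (in other words, a finitely generated simple group with the Liouville property; in particular this group is amenable).
   Context: Grigorchuk groups. The binary rooted tree is identified with the set $\{0,1\}^*$ of finite binary strings, rooted at the empty string, where $v,w$ are joined by an edge if $w=vx$ for some $x\in\{0,1\}$. Let $\Omega=\{\mathbf{0},\mathbf{1},\mathbf{2}\}^{\mathbb{N}_+}$ with shift map $\sigma:\Omega\to\Omega$, $(\sigma\omega)(n)=\omega(n+1)$. Let $\varepsilon$ be the non-trivial permutation of $\{0,1\}$ and for $i,j\in\{\mathbf{0},\mathbf{1},\mathbf{2}\}$ let $\varepsilon_{ij}=\varepsilon$ if $i\ne j$ and $\varepsilon_{ij}=\mathrm{id}$ if $i=j$. For $\omega\in\Omega$, $G_\omega$ is the group of automorphisms of the tree generated by $a,b_\omega,c_\omega,d_\omega$, where for all $x\in\{0,1\}$, $v\in\{0,1\}^*$: $a(xv)=\varepsilon(x)v$; $b_\omega(0xv)=0\,\varepsilon_{\mathbf{2}\omega(1)}(x)v$, $b_\omega(1v)=1\,b_{\sigma\omega}(v)$; $c_\omega(0xv)=0\,\varepsilon_{\mathbf{1}\omega(1)}(x)v$, $c_\omega(1v)=1\,c_{\sigma\omega}(v)$; $d_\omega(0xv)=0\,\varepsilon_{\mathbf{0}\omega(1)}(x)v$, $d_\omega(1v)=1\,d_{\sigma\omega}(v)$;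 all four generators fix the empty string, and $b_\omega,c_\omega,d_\omega$ fix the one-letter string $0$. A probability measure $\mu$ on a group $G$ is symmetric if $\mu(g)=\mu(g^{-1})$ for all $g$. Its Poisson--Furstenberg boundary is trivial if and only if every bounded $\mu$-harmonic function on the subgroup generated by the support of $\mu$ is constant, where $f$ is $\mu$-harmonic if $f(g)=\sum_h f(gh)\mu(h)$ for all $g$. *)

(* Defs.v *)
From HB Require Import structures.
From mathcomp Require Import all_boot all_order all_algebra.
From mathcomp Require Import boolp classical_sets cardinality fsbigop reals.

Set Implicit Arguments.
Unset Strict Implicit.
Unset Printing Implicit Defensive.

Import Order.TTheory GRing.Theory Num.Theory.

Local Open Scope classical_set_scope.
Local Open Scope group_scope.

Definition is_subgroup (G : groupType) (K : set G) : Prop :=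
  [/\ K 1, forall x y, K x -> K y -> K (x * y) & forall x, K x -> K x^-1].

Definition gen_set (G : groupType) (S : set G) : set G := smallest (@is_subgroup G) S.

Lemma gen_set_subgroup (G : groupType) (S : set G) : is_subgroup (gen_set S).
Proof.
split=> [K [[]] //|x y Kx Ky K KS|x Kx K KS].
- by case: (KS) => -[_ KM _] _; apply: KM; [apply: Kx|apply: Ky].
- by case: (KS) => -[_ _ KV] _; apply: KV; apply: Kx.
Qed.

Definition generated (G : groupType) (S : set G) : Type := set_type (gen_set S).

HB.instance Definition _ (G : groupType) (S : set G) :=
  SubChoice.on (generated S).

Lemma gen_set_closed (G : groupType) (S : set G) :
  group_closed (fun x : G => x \in gen_set S).
Proof.
have [K1 KM KV] := gen_set_subgroup S.
split=> [|x y]; rewrite -!topredE /= !inE //.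
by move=> Kx Ky; apply: KM => //; apply: KV.
Qed.

HB.instance Definition _ (G : groupType) (S : set G) :=
  SubChoice_isSubGroup.Build G (fun x : G => x \in gen_set S) (generated S)
    (gen_set_closed S).

Definition finitely_generated (G : groupType) : Prop :=
  exists2 S : set G, finite_set S & gen_set S = [set: G].

Definition is_normal (G : groupType) (N : set G) : Prop :=
  is_subgroup N /\ forall x g, N x -> N (x ^ g).

Definition simple_group (G : groupType) : Prop :=
  (exists x : G, x <> 1) /\
  forall N : set G, is_normal N -> N = [set 1] \/ N = [set: G].

Definition embeds_in (G H : groupType) : Prop :=
  exists phi : {multiplicative G -> H}, injective phi.

(* Vertices are finite binary strings, with false for 0 and true for 1. *)
Definition vertex := seq bool.

Definition tree_edge (v w : vertex) : Prop :=
  (exists x, w = rcons v x) \/ (exists x, v = rcons w x).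

Record tree_aut := TreeAut {
  aut_fun :> vertex -> vertex;
  aut_inv : vertex -> vertex;
  aut_funK : cancel aut_fun aut_inv;
  aut_invK : cancel aut_inv aut_fun;
  aut_root : aut_fun [::] = [::];
  aut_edge : forall v w, tree_edge (aut_fun v) (aut_fun w) <-> tree_edge v w }.

HB.instance Definition _ := gen_eqMixin tree_aut.
HB.instance Definition _ := gen_choiceMixin tree_aut.

Lemma tree_autP (g h : tree_aut) : g =1 h -> g = h.
Proof.
case: g h => [g g' gK g'K g1 ge] [h h' hK h'K h1 he] /= gh.
have {}gh : g = h by apply/funext.
subst h; have gh' : g' = h'.
  by apply/funext => v; rewrite -{1}(h'K v) gK.
by subst h'; congr TreeAut; exact: Prop_irrelevance.
Qed.

Definition aut_one : tree_aut.
Proof. by apply: (@TreeAut id id). Defined.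

Definition aut_mul (g h : tree_aut) : tree_aut.
Proof.
apply: (@TreeAut (g \o h) (aut_inv h \o aut_inv g)).
- by move=> v /=; rewrite !aut_funK.
- by move=> v /=; rewrite !aut_invK.
- by rewrite /= !aut_root.
- by move=> v w /=; rewrite !aut_edge.
Defined.

Definition aut_invg (g : tree_aut) : tree_aut.
Proof.
apply: (@TreeAut (aut_inv g) g).
- exact: aut_invK.
- exact: aut_funK.
- by rewrite -{1}(aut_root g) aut_funK.
- by move=> v w; rewrite -(aut_edge g) !aut_invK.
Defined.

Lemma aut_mulA : associative aut_mul.
Proof. by move=> g h k; apply: tree_autP. Qed.
Lemma aut_mul1g : left_id aut_one aut_mul.
Proof. by move=> g; apply: tree_autP. Qed.
Lemma aut_mulg1 : right_id aut_one aut_mul.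
Proof. by move=> g; apply: tree_autP. Qed.
Lemma aut_mulVg : left_inverse aut_one aut_invg aut_mul.
Proof. by move=> g; apply: tree_autP => v /=; rewrite aut_funK. Qed.
Lemma aut_mulgV : right_inverse aut_one aut_invg aut_mul.
Proof. by move=> g; apply: tree_autP => v /=; rewrite aut_invK. Qed.

HB.instance Definition _ := isGroup.Build tree_aut
  aut_mulA aut_mul1g aut_mulg1 aut_mulVg aut_mulgV.

(* Sequences are indexed from 0: omega n stands for omega(n+1). *)
Definition Omega := nat -> 'I_3.

Definition shift (omega : Omega) : Omega := fun n => omega n.+1.

Definition eps (i j : 'I_3) (x : bool) : bool := if i == j then x else ~~ x.

Definition a_fun (v : vertex) : vertex :=
  if v is x :: v' then ~~ x :: v' else [::].

(* The common recursion of b, c and d, which use i = 2, 1 and 0. *)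
Fixpoint bcd_fun (i : 'I_3) (omega : Omega) (v : vertex) : vertex :=
  match v with
  | false :: x :: v' => false :: eps i (omega 0%N) x :: v'
  | true :: v' => true :: bcd_fun i (shift omega) v'
  | _ => v
  end.

Lemma edge_of_rcons (f : vertex -> vertex) : involutive f ->
  (forall v x, exists y, f (rcons v x) = rcons (f v) y) ->
  forall v w, tree_edge (f v) (f w) <-> tree_edge v w.
Proof.
move=> fK fr.
have H v w : tree_edge v w -> tree_edge (f v) (f w).
  by move=> [] [x ->]; [left|right]; apply: fr.
by move=> v w; split=> [/H|/H //]; rewrite !fK.
Qed.

Lemma a_funK : involutive a_fun.
Proof. by case=> //= x v; rewrite negbK. Qed.

Lemma a_fun_rcons v x : exists y, a_fun (rcons v x) = rcons (a_fun v) y.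
Proof. by case: v => [|y v]; [exists (~~ x)|exists x]. Qed.

Lemma epsK i j : involutive (eps i j).
Proof. by rewrite /eps => x; case: eqP => // _; rewrite negbK. Qed.

Lemma bcd_funK i omega : involutive (bcd_fun i omega).
Proof.
move=> v; elim: v omega => [|[] v IH] omega //=; first by rewrite IH.
by case: v {IH} => //= x v; rewrite epsK.
Qed.

Lemma bcd_fun_rcons i omega v x :
  exists y, bcd_fun i omega (rcons v x) = rcons (bcd_fun i omega v) y.
Proof.
elim: v omega => [|[] v IH] omega /=; first by exists x; case: x.
  by have [y ->] := IH (shift omega); exists y.
by case: v {IH} => [|z v] /=; [exists (eps i (omega 0%N) x)|exists x].
Qed.

Definition gen_a : tree_aut :=
  TreeAut a_funK a_funK erefl (edge_of_rcons a_funK a_fun_rcons).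

Definition gen_bcd (i : 'I_3) (omega : Omega) : tree_aut :=
  TreeAut (bcd_funK i omega) (bcd_funK i omega) erefl
    (edge_of_rcons (bcd_funK i omega) (bcd_fun_rcons i omega)).

Definition gen_b : Omega -> tree_aut := gen_bcd (@Ordinal 3 2 isT).
Definition gen_c : Omega -> tree_aut := gen_bcd (@Ordinal 3 1 isT).
Definition gen_d : Omega -> tree_aut := gen_bcd (@Ordinal 3 0 isT).

Definition grigorchuk (omega : Omega) : groupType :=
  generated [set gen_a; gen_b omega; gen_c omega; gen_d omega].

Local Open Scope ring_scope.

Definition mass_support (R : realType) (G : groupType) (mu : G -> R) : set G :=
  [set g | mu g != 0].

(* A finitely supported probability measure is given by its mass function; the
   finitely supported sum \sum_(g \in A) is the true sum by the second clause. *)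
Definition finsupp_probability (R : realType) (G : groupType) (mu : G -> R) :=
  [/\ forall g, 0 <= mu g, finite_set (mass_support mu)
    & \sum_(g \in [set: G]) mu g = 1].

Definition symmetric_measure (R : realType) (G : groupType) (mu : G -> R) :=
  forall g : G, mu g = mu g^-1%g.

(* Harmonic functions are taken on the subgroup generated by the support of mu,
   outside of which mu has no mass. *)
Definition harmonic (R : realType) (G : groupType) (mu : G -> R)
    (f : generated (mass_support mu) -> R) : Prop :=
  forall g, f g =
    \sum_(h \in [set: generated (mass_support mu)]) f (g * h)%g * mu (val h).

Definition bounded_function (R : realType) (T : Type) (f : T -> R) : Prop :=
  exists M : R, forall x, `|f x| <= M.

Definition trivial_boundary (R : realType) (G : groupType) (mu : G -> R) :=
  forall f : generated (mass_support mu) -> R,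
    bounded_function f -> harmonic f -> forall x y, f x = f y.

Definition liouville (R : realType) (G : groupType) : Prop :=
  forall mu : G -> R, finsupp_probability mu -> symmetric_measure mu ->
    trivial_boundary mu.

(* Amenability of a discrete group: there is a left-invariant finitely additive
   probability measure defined on all subsets. *)
Definition amenable (R : realType) (G : groupType) : Prop :=
  exists m : set G -> R,
    [/\ forall A, 0 <= m A,
        m [set: G] = 1,
        forall A B, A `&` B = set0 -> m (A `|` B) = m A + m B
      & forall (g : G) A, m [set (g * x)%g | x in A] = m A].

(* Main.v *)
Require Import Defs.
From HB Require Import structures.
From mathcomp Require Import all_boot all_order all_algebra.
From mathcomp Require Import boolp classical_sets cardinality fsbigop reals.
From mathcomp Require Import filter topology normedtype exp.
From mathcomp Require Import zify ring lra.

(** A Grigorchuk group acts on lines: the Schreier graphs of its action on the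
    boundary of the tree are lines, in which consecutive vertices are joined by
    edges labelled with generators, and the labels along a line form a sequence
    that is determined by the 2-adic valuations of the positions. The group
    [H] is found among the permutations of the integers that read such a
    sequence [w] and move every point by an amount that depends only on the
    pattern of [w] around it ([locperm]). These permutations form the
    topological full group of the subshift generated by [w], seen on the single
    orbit of [w], and [H] is the subgroup generated by its 3-cycles.

    Three properties of [w] carry everything else: each pattern recurs along an
    arithmetic progression ([recurrent]), a long pattern does not recur at a
    short distance ([sparse_patterns]), and the number of patterns of radius [r]
    is linear in [r] ([linear_complexity]). They hold for the sequences
    [n |-> l (val2 (3 * n + 8))], where [l] takes finitely many values, any two
    consecutive ones of which are distinct.

    Finite generation ([three_cycles_fg]): the commutator of two 3-cycles that
    share one entry is a 3-cycle, and when the two are spread along sets [D] and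
    [D'] the commutator is spread along the intersection of [D] and [D'].
    Starting with short patterns one obtains all the longer ones.

    Simplicity ([three_cycles_simple]): an element [g] of a normal subgroup that
    moves the occurrences [V] of some pattern off themselves yields, by double
    commutators, all the commutators of elements supported in [V]; conjugation
    carries the resulting 3-cycles everywhere, because the pattern recurs.

    Embedding ([grigorchuk_embeds]): the Gray code identifies the line with an
    orbit of rays, so that the generators [a], [b], [c], [d] act by exchanging
    neighbours. Two copies of the line are used, which turns these exchanges into
    products of double transpositions, hence of 3-cycles.

    Liouville property ([local_liouville]): a symmetric random walk on [H] moves
    each integer by a reversible walk on the line. By the Varopoulos--Carne bound
    ([carne]) displacements much larger than [sqrt n] in [n] steps are so
    unlikely that, as there are only polynomially many patterns to consider, none
    occurs with high probability. The element reached at time [n] is then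
    determined by its values on the patterns of radius about
    [n ^ (3 / 4)], whose number is linear, and the entropy is at most of order
    [n ^ (3 / 4) * ln n] ([sublinear_entropy]). Sublinear entropy makes the laws
    of [g X_n] and [X_(n+1)] close in total variation at suitable times
    ([slow_entropy_mixing]), which makes bounded harmonic functions constant and,
    along an ultrafilter, provides an invariant mean ([mixing_amenable]). *)

Set Implicit Arguments.
Unset Strict Implicit.
Unset Printing Implicit Defensive.

Import Order.TTheory GRing.Theory Num.Theory.
Import numFieldNormedType.Exports.

Local Open Scope classical_set_scope.
Local Open Scope ring_scope.

(** * Permutations of the integers *)

Record zperm := ZPerm {
  zp_fun :> int -> int;
  zp_inv : int -> int;
  zp_funK : cancel zp_fun zp_inv;
  zp_invK : cancel zp_inv zp_fun }.

HB.instance Definition _ := gen_eqMixin zperm.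
HB.instance Definition _ := gen_choiceMixin zperm.

Lemma zpermP (g h : zperm) : g =1 h -> g = h.
Proof.
case: g h => [g g' gK g'K] [h h' hK h'K] /= gh.
have {}gh : g = h by apply/funext.
subst h; have gh' : g' = h'.
  by apply/funext => v; rewrite -{1}(h'K v) gK.
by subst h'; congr ZPerm; exact: Prop_irrelevance.
Qed.

Definition zp_one : zperm := @ZPerm id id (fun=> erefl) (fun=> erefl).

Definition zp_mul (g h : zperm) : zperm :=
  @ZPerm (g \o h) (zp_inv h \o zp_inv g)
    (can_comp (zp_funK g) (zp_funK h)) (can_comp (zp_invK h) (zp_invK g)).

Definition zp_invg (g : zperm) : zperm := ZPerm (zp_invK g) (zp_funK g).

Lemma zp_mulA : associative zp_mul.
Proof. by move=> g h k; apply: zpermP. Qed.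
Lemma zp_mul1g : left_id zp_one zp_mul.
Proof. by move=> g; apply: zpermP. Qed.
Lemma zp_mulg1 : right_id zp_one zp_mul.
Proof. by move=> g; apply: zpermP. Qed.
Lemma zp_mulVg : left_inverse zp_one zp_invg zp_mul.
Proof. by move=> g; apply: zpermP => v /=; rewrite zp_funK. Qed.
Lemma zp_mulgV : right_inverse zp_one zp_invg zp_mul.
Proof. by move=> g; apply: zpermP => v /=; rewrite zp_invK. Qed.

HB.instance Definition _ := isGroup.Build zperm
  zp_mulA zp_mul1g zp_mulg1 zp_mulVg zp_mulgV.

Lemma zpM (g h : zperm) m : (g * h)%g m = g (h m). Proof. by []. Qed.
Lemma zp1 m : (1%g : zperm) m = m. Proof. by []. Qed.
Lemma zpK (g : zperm) : cancel g (g^-1)%g. Proof. exact: zp_funK. Qed.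
Lemma zpKV (g : zperm) : cancel (g^-1)%g g. Proof. exact: zp_invK. Qed.
Lemma zp_inj (g : zperm) : injective g. Proof. exact: can_inj (zp_funK g). Qed.

Definition tp_fun (x y m : int) : int :=
  if m == x then y else if m == y then x else m.

(* Tests containing a conditional are left for later, so that nested
   conditionals are resolved from the inside. *)
Ltac case_eqs := repeat (match goal with |- context [?a == ?b] =>
  lazymatch a with context [if _ then _ else _] => fail | _ =>
  lazymatch b with context [if _ then _ else _] => fail | _ =>
  case: (a =P b) => ? //= end end end); congruence.

Lemma tp_funK x y : involutive (tp_fun x y).
Proof. by move=> m; rewrite /tp_fun; case_eqs. Qed.

Definition tp x y : zperm := ZPerm (tp_funK x y) (tp_funK x y).

Lemma tpE x y m : tp x y m = if m == x then y else if m == y then x else m.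
Proof. by []. Qed.

Lemma tpV x y : ((tp x y)^-1 = tp x y)%g.
Proof. exact: zpermP. Qed.

Lemma tpC x y : tp x y = tp y x.
Proof.
by apply: zpermP => m; rewrite !tpE; case_eqs.
Qed.

Lemma tpJ (g : zperm) x y : (g * tp x y * g^-1 = tp (g x) (g y))%g.
Proof.
apply: zpermP => m; rewrite !zpM !tpE.
rewrite !(can2_eq (zpKV g) (zpK g)).
by do 2 case: ifP => // _; rewrite zpKV.
Qed.

(** The cycle x -> y -> z -> x; as a product of transpositions it is a
    permutation even when its entries are not distinct. *)
Definition cyc x y z : zperm := (tp x y * tp y z)%g.

Lemma cycJ (g : zperm) x y z :
  (g * cyc x y z * g^-1 = cyc (g x) (g y) (g z))%g.
Proof. by rewrite /cyc -!tpJ !mulgA mulgVK. Qed.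

Lemma cycV x y z : ((cyc x y z)^-1 = cyc z y x)%g.
Proof. by rewrite /cyc invgM !tpV (tpC y z) (tpC x y). Qed.

Definition distinct3 (x y z : int) := [&& x != y, y != z & x != z].

Lemma distinct3P x y z : distinct3 x y z -> [/\ x <> y, y <> z & x <> z].
Proof. by move=> /and3P[/eqP ? /eqP ? /eqP ?]. Qed.

Lemma cycE x y z m : distinct3 x y z ->
  cyc x y z m = if m == x then y else if m == y then z else
                if m == z then x else m.
Proof. by move=> /distinct3P[? ? ?]; rewrite zpM !tpE; case_eqs. Qed.

Lemma cyc_rot x y z : distinct3 x y z -> cyc x y z = cyc y z x.
Proof.
move=> d; have d' : distinct3 y z x by rewrite /distinct3 in d *; lia.
by apply: zpermP => m; rewrite !cycE //; case: (distinct3P d) => ? ? ?; case_eqs.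
Qed.

(** Two 3-cycles with the single common entry [b] have a 3-cycle as their
    commutator. This is what intersects domains in [spread_commg]. *)
Lemma cyc_commg a b c y v : uniq [:: a; b; c; y; v] ->
  (cyc c y b * cyc b a v * (cyc c y b)^-1 * (cyc b a v)^-1 = cyc a b c)%g.
Proof.
rewrite /= !inE !negb_or !andbT.
move=> /and4P[/and4P[/eqP? /eqP? /eqP? /eqP?] /and3P[/eqP? /eqP? /eqP?]].
move=> /andP[/eqP? /eqP?] /eqP?; rewrite cycJ cycV.
have d3 p q r : p <> q -> q <> r -> p <> r -> distinct3 p q r.
  by move=> /eqP pq /eqP qr /eqP pr; rewrite /distinct3 pq qr pr.
rewrite [cyc c y b b]cycE; last by apply: d3; congruence.
rewrite [cyc c y b a]cycE; last by apply: d3; congruence.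
rewrite [cyc c y b v]cycE; last by apply: d3; congruence.
rewrite eqxx; have -> : (if b == c then y else if b == y then b else c) = c.
  by case_eqs.
have -> : (if a == c then y else if a == y then b else if a == b then c else a) = a.
  by case_eqs.
have -> : (if v == c then y else if v == y then b else if v == b then c else v) = v.
  by case_eqs.
apply: zpermP => m; rewrite zpM !cycE; try (apply: d3; congruence).
by case_eqs.
Qed.

(** * Spreading a finite permutation along a sparse set *)

(** The translates of the block [[0, M)] by the points of an [M]-separated set
    are disjoint, so that a permutation supported in [[0, M)] can be copied in
    each of them. *)
Definition sep (M : int) (D : set int) :=
  forall n n', D n -> D n' -> `|n - n'| < M -> n = n'.

Definition supp_lt (M : int) (al : zperm) :=
  forall i, ~~ (0 <= i < M) -> al i = i.

Lemma supp_lt_range M al i : supp_lt M al -> 0 <= i < M -> 0 <= al i < M.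
Proof.
move=> sal iM; apply: contraT => /[dup] /sal /zp_inj ->.
by rewrite iM.
Qed.

Lemma supp_ltM M al be : supp_lt M al -> supp_lt M be -> supp_lt M (al * be)%g.
Proof. by move=> sa sb i iM; rewrite zpM sb // sa. Qed.

Lemma supp_ltV M al : supp_lt M al -> supp_lt M (al^-1)%g.
Proof. by move=> sa i /sa {1}<-; rewrite zpK. Qed.

Lemma supp_lt_cyc M x y z : 0 <= x < M -> 0 <= y < M -> 0 <= z < M ->
  supp_lt M (cyc x y z).
Proof.
move=> xM yM zM i iM; rewrite zpM !tpE.
have [ix iy iz] : [/\ i <> x, i <> y & i <> z] by split=> ii; subst; lia.
by case_eqs.
Qed.

Lemma sepS M M' D D' : M <= M' -> D' `<=` D -> sep M' D -> sep M D'.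
Proof. move=> MM DD sD n n' /DD Dn /DD Dn' nn; apply: sD => //; lia. Qed.

Definition is_spread (M : int) (D : set int) (al g : zperm) :=
  (forall n i, D n -> 0 <= i < M -> g (n + i) = n + al i) /\
  (forall m, (forall n, D n -> ~~ (0 <= m - n < M)) -> g m = m).

Definition spread (M : int) (D : set int) (al : zperm) : zperm :=
  xget 1%g [set g | is_spread M D al g].

Lemma nearP (M : int) (D : set int) m :
  (exists n i, [/\ D n, 0 <= i < M & m = n + i]) \/
  (forall n, D n -> ~~ (0 <= m - n < M)).
Proof.
have [[n [Dn mn]]|nD] := pselect (exists n, D n /\ 0 <= m - n < M).
  by left; exists n, (m - n); rewrite mn; split=> //; lia.
by right=> n Dn; apply/negP => mn; apply: nD; exists n.
Qed.

Definition spread_fun (M : int) (D : set int) (al : zperm) (m : int) : int :=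
  let n := xget 0 [set n | D n /\ 0 <= m - n < M] in
  if `[< exists n, D n /\ 0 <= m - n < M >] then n + al (m - n) else m.

Lemma spread_fun_in M D al n i : sep M D -> D n -> 0 <= i < M ->
  spread_fun M D al (n + i) = n + al i.
Proof.
move=> sD Dn iM; rewrite /spread_fun asboolT; last first.
  by exists n; split=> //; lia.
case: xgetP => [n' _ [Dn' n'i]|/(_ n) []]; last by split=> //; lia.
have <- : n = n' by apply: sD => //; lia.
by congr (_ + al _); lia.
Qed.

Lemma spread_fun_out M D al m : (forall n, D n -> ~~ (0 <= m - n < M)) ->
  spread_fun M D al m = m.
Proof.
by move=> mD; rewrite /spread_fun asboolF // => -[n [/mD/negP]].
Qed.

Lemma spread_funK M D al be : sep M D -> supp_lt M al -> supp_lt M be ->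
  cancel al be -> cancel (spread_fun M D al) (spread_fun M D be).
Proof.
move=> sD sa sb ab m; have [[n [i [Dn iM ->]]]|mD] := nearP M D m.
  by rewrite !spread_fun_in // ?ab //; apply: supp_lt_range.
by rewrite !spread_fun_out.
Qed.

Lemma spreadP M D al : sep M D -> supp_lt M al ->
  is_spread M D al (spread M D al).
Proof.
move=> sD sa; have sV := supp_ltV sa; rewrite /spread; case: xgetP => // nex.
have := nex (ZPerm (spread_funK sD sa sV (@zpK al))
                   (spread_funK sD sV sa (@zpKV al))).
case; split=> /=; first by move=> n i Dn iM; rewrite spread_fun_in.
by move=> m mD; rewrite spread_fun_out.
Qed.

(** Within a sparse set [E], the spread of a permutation along a subset of [E]
    acts on the block above each point of [E] separately; all identities below
    are read off block by block. *)
Lemma spreadE M E D al n i : sep M E -> D `<=` E -> supp_lt M al ->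
  E n -> 0 <= i < M ->
  spread M D al (n + i) = n + (if `[< D n >] then al i else i).
Proof.
move=> sE DE sa En iM; have [sI sO] := spreadP (sepS (lexx _) DE sE) sa.
case: asboolP => Dn; first exact: sI.
apply: sO => n' Dn'; apply/negP => ni; apply: Dn.
by have -> : n = n' by apply: sE => //; [exact: DE|lia].
Qed.

Lemma spread_out M E D al m : sep M E -> D `<=` E -> supp_lt M al ->
  (forall n, E n -> ~~ (0 <= m - n < M)) -> spread M D al m = m.
Proof.
move=> sE DE sa mE; have [_ sO] := spreadP (sepS (lexx _) DE sE) sa.
by apply: sO => n /DE/mE.
Qed.

Lemma spread_uniq M D al g : sep M D -> supp_lt M al ->
  is_spread M D al g -> g = spread M D al.
Proof.
move=> sD sa [gI gO]; have [sI sO] := spreadP sD sa.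
apply: zpermP => m; have [[n [i [Dn iM ->]]]|mD] := nearP M D m.
  by rewrite gI // sI.
by rewrite gO // sO.
Qed.

Section SpreadAlgebra.
Context (M : int) (E : set int) (sE : sep M E).

Lemma spreadM D al be : D `<=` E -> supp_lt M al -> supp_lt M be ->
  spread M D (al * be)%g = (spread M D al * spread M D be)%g.
Proof.
move=> DE sa sb; have sD := sepS (lexx M) DE sE.
symmetry; apply: spread_uniq => //; first exact: supp_ltM.
split=> [n i Dn iM|m mD]; rewrite zpM; last first.
  by rewrite !(spread_out sD).
rewrite (spreadE sD) // asboolT // (spreadE sD) ?asboolT //.
exact: supp_lt_range.
Qed.

(** Above the points of both [D] and [D'] a commutator appears; above the other
    points at most one of the two factors acts, so they commute. *)
Lemma spread_swap D D' al be : D `<=` E -> D' `<=` E ->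
  supp_lt M al -> supp_lt M be ->
  (spread M D al * spread M D' be =
   spread M (D `&` D') (al * be * al^-1 * be^-1) *
     (spread M D' be * spread M D al))%g.
Proof.
move=> DE DE' sa sb.
have DDE : D `&` D' `<=` E by move=> x [/DE].
have sab : supp_lt M (al * be * al^-1 * be^-1)%g.
  by do !apply: supp_ltM => //; apply: supp_ltV.
have ra i := @supp_lt_range M al i sa; have rb i := @supp_lt_range M be i sb.
apply: zpermP => m; have [[n [i [En iM ->]]]|mE] := nearP M E m; last first.
  by rewrite !zpM; do !rewrite (spread_out (m := m) sE) //.
rewrite !zpM (spreadE sE (D := D')) // (spreadE sE (D := D) (n := n) (i := i)) //.
rewrite (spreadE sE (D := D')) //; last by case: ifP => // _; apply: ra.
rewrite (spreadE sE (D := D)) //; last by case: ifP => // _; apply: rb.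
rewrite (spreadE sE (D := D `&` D')) //; last first.
  by do 2 (case: ifP => _ //); [apply/rb/ra|apply: rb|apply: ra].
have -> : `[< (D `&` D') n >] = `[< D n >] && `[< D' n >].
  by apply/asboolP/andP => -[] => [? ?|/asboolP ? /asboolP ?];
    split=> //; apply/asboolP.
by do 2 case: asboolP => _ //; rewrite !zpM !zpK.
Qed.

Lemma spread_commg D D' al be : D `<=` E -> D' `<=` E ->
  supp_lt M al -> supp_lt M be ->
  (spread M D al * spread M D' be * (spread M D al)^-1 * (spread M D' be)^-1 =
   spread M (D `&` D') (al * be * al^-1 * be^-1))%g.
Proof. by move=> ? ? ? ?; rewrite spread_swap // !mulgA !mulgK. Qed.

Lemma spreadJ D D' al be : D `<=` D' -> D' `<=` E ->
  supp_lt M al -> supp_lt M be ->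
  (spread M D' be * spread M D al * (spread M D' be)^-1 =
   spread M D (be * al * be^-1))%g.
Proof.
move=> DD' DE sa sb; have DE' : D `<=` E by move=> x /DD' /DE.
rewrite spread_swap // (_ : D' `&` D = D) ?mulgA ?mulgK; last first.
  by apply/seteqP; split=> [x []|x Dx] //; split=> //; apply: DD'.
have sab : supp_lt M (be * al * be^-1 * al^-1)%g.
  by do !apply: supp_ltM => //; apply: supp_ltV.
by rewrite -spreadM // mulgVK.
Qed.

Lemma spreadU D D' al : D `<=` E -> D' `<=` E -> D `&` D' = set0 ->
  supp_lt M al ->
  spread M (D `|` D') al = (spread M D al * spread M D' al)%g.
Proof.
move=> DE DE' DD sa.
have DUE : D `|` D' `<=` E by move=> x [/DE|/DE'].
apply: zpermP => m; have [[n [i [En iM ->]]]|mE] := nearP M E m; last first.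
  by rewrite !zpM; do !rewrite (spread_out (m := m) sE) //.
have ra i' := @supp_lt_range M al i' sa.
rewrite zpM (spreadE sE (D := D `|` D')) // (spreadE sE (D := D')) //.
rewrite (spreadE sE (D := D)) //; last by case: ifP => // _; apply: ra.
have [D'n|D'n] := asboolP (D' n); have [Dn|Dn] := asboolP (D n).
- by have : (D `&` D') n by []; rewrite DD.
- by rewrite asboolT //; right.
- by rewrite asboolT //; left.
- by rewrite asboolF // => -[].
Qed.

End SpreadAlgebra.

Lemma spread_set0 M al : spread M set0 al = 1%g.
Proof.
rewrite /spread; case: xgetP => // g _ [_ gO].
by apply: zpermP => m; rewrite gO // => n [].
Qed.

Lemma spread_widen M M' D al : M <= M' -> sep M' D -> supp_lt M al ->
  spread M D al = spread M' D al.
Proof.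
move=> MM sD sa; have sa' : supp_lt M' al.
  by move=> i iM; apply: sa; lia.
have sD' : sep M D by exact: sepS sD.
apply: spread_uniq => //; split=> [n i Dn iM|m mD]; last first.
  by apply: (spread_out sD') => // n /mD; lia.
have [iM'|iM'] := boolP (0 <= i < M).
  by rewrite (spreadE sD') // asboolT.
rewrite sa //; apply: (spread_out sD') => // n' Dn'; apply/negP => nn.
by have nn' : n = n' by [apply: sD => //; lia]; lia.
Qed.

(** The block length [M] does not occur in this description, hence the change
    of blocks in [spread_shift]. *)
Lemma spread_cycE M D x y z m : sep M D -> distinct3 x y z ->
  0 <= x < M -> 0 <= y < M -> 0 <= z < M ->
  [/\ D (m - x) -> spread M D (cyc x y z) m = m - x + y,
      D (m - y) -> spread M D (cyc x y z) m = m - y + z,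
      D (m - z) -> spread M D (cyc x y z) m = m - z + x
    & ~ D (m - x) -> ~ D (m - y) -> ~ D (m - z) ->
      spread M D (cyc x y z) m = m].
Proof.
move=> sD d xM yM zM; have sc := supp_lt_cyc xM yM zM.
have [sI sO] := spreadP sD sc.
have [xy yz xz] := distinct3P d.
split=> [Dm|Dm|Dm|Dx Dy Dz].
- by rewrite -{1}(subrK x m) sI // cycE // eqxx.
- rewrite -{1}(subrK y m) sI // cycE // eqxx.
  by case: eqP => [?|//]; congruence.
- rewrite -{1}(subrK z m) sI // cycE // eqxx.
  by case: eqP => [?|_]; [congruence|case: eqP => [?|//]; congruence].
have [[n [i [Dn iM mE]]]|mD] := nearP M D m; last exact: sO.
rewrite {1}mE sI // cycE //.
have nx : i <> x by move=> ix; apply: Dx; rewrite mE ix addrK.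
have ny : i <> y by move=> ix; apply: Dy; rewrite mE ix addrK.
have nz : i <> z by move=> ix; apply: Dz; rewrite mE ix addrK.
by rewrite mE; case_eqs.
Qed.

(** Moving the base points by [t] moves the entries by [- t]. *)
Lemma spread_shift M M' D D' t x y z :
  sep M D' -> sep M' D -> distinct3 x y z -> (forall n, D' n <-> D (n - t)) ->
  0 <= x < M -> 0 <= y < M -> 0 <= z < M ->
  0 <= x + t < M' -> 0 <= y + t < M' -> 0 <= z + t < M' ->
  spread M D' (cyc x y z) = spread M' D (cyc (x + t) (y + t) (z + t)).
Proof.
move=> sD' sD d DD xM yM zM xM' yM' zM'.
have d' : distinct3 (x + t) (y + t) (z + t) by move: d; rewrite /distinct3; lia.
apply: zpermP => m.
have [Ex Ey Ez Eo] := spread_cycE m sD' d xM yM zM.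
have [Ex' Ey' Ez' Eo'] := spread_cycE m sD d' xM' yM' zM'.
have e a : D (m - (a + t)) <-> D' (m - a).
  by rewrite DD (_ : m - a - t = m - (a + t)) //; lia.
have [Dx|Dx] := pselect (D' (m - x)); first by rewrite Ex // Ex' ?e //; lia.
have [Dy|Dy] := pselect (D' (m - y)); first by rewrite Ey // Ey' ?e //; lia.
have [Dz|Dz] := pselect (D' (m - z)); first by rewrite Ez // Ez' ?e //; lia.
by rewrite Eo // Eo' // e.
Qed.

(** * Patterns of a two-sided sequence *)

Section Patterns.
Context (A : Type) (w : int -> A).

Definition agree (r : nat) (n n' : int) :=
  forall i : int, `|i| <= r%:Z -> w (n + i) = w (n' + i).

Definition pattern (r : nat) (v : int) : set int := [set n | agree r v n].

(** Local sets are the traces on the orbit of [w] of the clopen subsets of the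
    subshift generated by [w]; local permutations are the elements of its
    topological full group. *)
Definition locset_at r (D : set int) := forall n n', agree r n n' -> D n -> D n'.

Definition locset (D : set int) := exists r, locset_at r D.

Definition locperm_at r (g : zperm) :=
  forall n n', agree r n n' -> g n' = g n + (n' - n).

Definition locperm (g : zperm) := exists r, locperm_at r g.

Definition recurrent := forall r v, exists2 p : int,
  0 < p & forall k : int, agree r v (v + k * p).

Definition sparse_patterns := forall M : int, exists r, forall v,
  sep M (pattern r v).

Definition patterns_bound r (s : seq int) :=
  forall n, exists2 v, v \in s & agree r v n.

Definition linear_complexity := exists C : nat, forall r,
  exists2 s : seq int, (size s <= C * r.+1)%N & patterns_bound r s.

(** Any bounded positions of the three entries relative to a local set are
    allowed, as long as blocks of some length [M] that contains them do not
    overlap. *)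
Definition three_cycles : set zperm := [set g | exists M D x y z,
  [/\ locset D, sep M D, distinct3 x y z,
      [/\ 0 <= x < M, 0 <= y < M & 0 <= z < M]
    & g = spread M D (cyc x y z)]].

Lemma agree_refl r n : agree r n n. Proof. by []. Qed.

Lemma agree_sym r n n' : agree r n n' -> agree r n' n.
Proof. by move=> nn i /nn. Qed.

Lemma agree_trans r n n' n'' : agree r n n' -> agree r n' n'' -> agree r n n''.
Proof. by move=> nn nn' i ir; rewrite nn // nn'. Qed.

Lemma agree_le r r' n n' : (r <= r')%N -> agree r' n n' -> agree r n n'.
Proof. by move=> rr nn i ir; apply: nn; lia. Qed.

Lemma agree_shift r r' n n' t : `|t| + r%:Z <= r'%:Z ->
  agree r' n n' -> agree r (n + t) (n' + t).
Proof. by move=> tr nn i ir; rewrite -!addrA; apply: nn; lia. Qed.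

Lemma locset_le r r' D : (r <= r')%N -> locset_at r D -> locset_at r' D.
Proof. by move=> rr lD n n' /(agree_le rr); apply: lD. Qed.

Lemma locset_pattern r v : locset_at r (pattern r v).
Proof. by move=> n n' nn vn; apply: agree_trans vn nn. Qed.

Lemma locset_atI r D D' : locset_at r D -> locset_at r D' ->
  locset_at r (D `&` D').
Proof. by move=> lD lD' n n' nn [Dn D'n]; split; [apply: lD Dn|apply: lD' D'n]. Qed.

Lemma locsetI D D' : locset D -> locset D' -> locset (D `&` D').
Proof.
move=> [r lD] [r' lD']; exists (maxn r r'); apply: locset_atI.
  by apply: locset_le lD; lia.
by apply: locset_le lD'; lia.
Qed.

Lemma locset_shift_at r t D : locset_at r D ->
  locset_at (r + `|t|) [set n | D (n + t)].
Proof. by move=> lD n n' nn; apply: lD; apply: agree_shift nn; lia. Qed.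

Lemma locset_pattern_sub r v D : locset_at r D ->
  D `&` pattern r v = set0 \/ D `&` pattern r v = pattern r v.
Proof.
move=> lD; have [Dv|nDv] := pselect (D v).
  by right; apply/seteqP; split=> [x []//|x vx]; split=> //; apply: lD Dv.
left; rewrite -subset0 => x [Dx vx]; apply: nDv.
by apply: lD Dx; apply: agree_sym.
Qed.

Section Bounded.
Context (lin : linear_complexity).

(** There are finitely many patterns of a given radius, and they partition the
    integers. *)
Lemma cover_ind r (P : set int -> Prop) (D : set int) : P set0 ->
  (forall B B', B `<=` D -> B' `<=` D -> B `&` B' = set0 -> P B -> P B' ->
    P (B `|` B')) ->
  (forall v, P (D `&` pattern r v)) -> P D.
Proof.
move=> P0 PU PD; have [C /(_ r) [s _ sP]] := lin.
pose U (s : seq int) := [set n | exists2 v, v \in s & agree r v n].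
suff : P (D `&` U s).
  by congr P; apply/seteqP; split=> [x []//|x Dx]; split=> //; apply: sP.
elim: s {sP} => [|v s IH].
  by rewrite (_ : D `&` _ = set0) // -subset0 => x [_ []].
have [[v' v's vv']|nv] := pselect (exists2 v', v' \in s & agree r v' v).
  move: IH; congr P; apply/seteqP; split=> x [Dx [u us ux]]; split=> //.
    by exists u => //; rewrite inE us orbT.
  move: us; rewrite inE => /predU1P[uv|us]; last by exists u.
  by exists v' => //; apply: agree_trans vv' _; rewrite -uv.
have -> : D `&` U (v :: s) = (D `&` pattern r v) `|` (D `&` U s).
  apply/seteqP; split=> x.
    move=> [Dx [u]]; rewrite inE => /predU1P[->|us] ux; first by left.
    by right; split=> //; exists u.
  case=> [[Dx vx]|[Dx [u us ux]]]; split=> //.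
    by exists v => //; rewrite inE eqxx.
  by exists u => //; rewrite inE us orbT.
apply: PU => //; try by move=> x [].
rewrite -subset0 => x [[_ vx] [_ [u us ux]]]; apply: nv; exists u => //.
by apply: agree_trans ux _; apply: agree_sym.
Qed.

Lemma locperm_bounded g : locperm g -> exists B : nat, forall n, `|g n - n| <= B%:Z.
Proof.
move=> [r lg]; have [C /(_ r) [s _ sP]] := lin.
pose d v := absz (g v - v).
exists (\max_(v <- s) d v)%N => n.
have [v vs vn] := sP n; rewrite (lg _ _ vn).
rewrite (_ : _ - _ = g v - v); last by lia.
have := @leq_bigmax_seq _ s xpredT d v vs isT.
by move: (\max_(v0 <- s) d v0)%N => m; rewrite /d; lia.
Qed.

Lemma locperm1 : locperm 1%g.
Proof. by exists 0%N => n n' _; rewrite !zp1; lia. Qed.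

(** The radius needed to know where [h] and then [g] move a point exceeds the
    radius of [g] by at most the displacement of [h]. *)
Lemma locperm_atM g h rg rh (B : nat) : locperm_at rg g -> locperm_at rh h ->
  (forall n, `|h n - n| <= B%:Z) ->
  locperm_at (maxn rh (rg + B)) (g * h)%g.
Proof.
move=> lg lh hB n n' nn; rewrite !zpM.
have hh : h n' = h n + (n' - n) by apply: lh; apply: agree_le nn; lia.
have -> : h n' = n' + (h n - n) by lia.
rewrite (lg (n + (h n - n))); last first.
  by apply: agree_shift nn; have := hB n; lia.
by rewrite (_ : n + (h n - n) = h n); lia.
Qed.

Lemma locpermM g h : locperm g -> locperm h -> locperm (g * h)%g.
Proof.
move=> [rg lg] lh; have [B hB] := locperm_bounded lh; case: lh => rh lh.
by eexists; apply: locperm_atM lg lh hB.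
Qed.

(** Displacements are bounded, so the pattern around the image of a point
    determines the pattern around the point. *)
Lemma locpermV g : locperm g -> locperm (g^-1)%g.
Proof.
move=> lg; have [B gB] := locperm_bounded lg; case: lg => r lg.
exists (r + B)%N => n n' nn.
apply: (@zp_inj g); rewrite zpKV.
set m := (g^-1)%g n; have mn : n = g m by rewrite zpKV.
have := gB m; rewrite -mn => mB.
have : agree r m (m + (n' - n)).
  rewrite (_ : m = n + (m - n)); last lia.
  rewrite (_ : n + (m - n) + (n' - n) = n' + (m - n)); last lia.
  by apply: agree_shift nn; lia.
by move/lg => ->; rewrite -mn; lia.
Qed.

(** Whether [m] lies in a block, and where in it, is read off the patterns around
    the points [m - i] for [i] in [[0, M)]. *)
Lemma locperm_spread M D al : locset D -> sep M D -> supp_lt M al ->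
  locperm (spread M D al).
Proof.
move=> [r lD] sD sa; exists (r + `|M|)%N => m m' mm'.
have [sI sO] := spreadP sD sa.
have key i : 0 <= i < M -> D (m - i) -> D (m' - i).
  by move=> iM; apply: lD; apply: agree_shift mm'; lia.
have key' i : 0 <= i < M -> D (m' - i) -> D (m - i).
  by move=> iM; apply: lD; apply: agree_shift (agree_sym mm'); lia.
have [[n [i [Dn iM mE]]]|mD] := nearP M D m.
  have Dn' : D (m' - i) by apply: key => //; rewrite mE addrK.
  by rewrite mE sI // -(subrK i m') sI //; lia.
rewrite !sO //; first lia.
move=> n Dn; apply/negP => nm.
have /mD : D (m - (m' - n)) by apply: key' => //; rewrite subKr.
by lia.
Qed.

Lemma three_cycles_locperm g : gen_set three_cycles g -> locperm g.
Proof.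
apply=> //; split; last first.
  move=> _ [M [D [x [y [z [lD sD d [xM yM zM] ->]]]]]].
  by apply: locperm_spread => //; apply: supp_lt_cyc.
split; [exact: locperm1|exact: locpermM|exact: locpermV].
Qed.

End Bounded.
End Patterns.

(** * Finite generation *)

Lemma generated_finite (G : groupType) (S S0 : set G) :
  finite_set S0 -> S0 `<=` gen_set S -> S `<=` gen_set S0 ->
  finitely_generated (generated S).
Proof.
move=> fS0 S0S SS0; exists [set h : generated S | S0 (val h)].
  apply: (@finite_preimage _ _ S0 (val : generated S -> G)) => //.
  by move=> x y _ _; apply: val_inj.
apply/seteqP; split=> // h _.
set S' := [set h | _].
have [S'1 S'M S'V] := gen_set_subgroup S'.
pose K : set G := [set g | exists2 h : generated S, gen_set S' h & val h = g].
have subK : is_subgroup K.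
  split; first by exists 1%g.
    by move=> _ _ [x Sx <-] [y Sy <-]; exists (x * y)%g => //; apply: S'M.
  by move=> _ [x Sx <-]; exists (x^-1)%g => //; apply: S'V.
have S0K : gen_set S0 `<=` K.
  move=> g /(_ K); apply; split=> // x S0x.
  have xS : x \in gen_set S by rewrite inE; apply: S0S.
  by exists (Sub x xS : generated S) => // L [_]; apply.
have : gen_set S (val h) by have := valP h; rewrite inE.
move=> /(_ K) []; first by split=> // x /SS0/S0K.
by move=> h' Sh' /val_inj <-.
Qed.

Lemma fresh4 (p a b c d : int) :
  exists2 q, p <= q < p + 5 & [&& q != a, q != b, q != c & q != d].
Proof.
pose s := [:: p; p + 1; p + 2; p + 3; p + 4].
have us : uniq s by rewrite /= !inE; lia.
have /allPn[q qs] : ~~ all (fun q => q \in [:: a; b; c; d]) s.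
  by apply/negP => /allP/(uniq_leq_size us).
rewrite !inE !negb_or => qn; exists q => //.
by move: qs; rewrite !inE; lia.
Qed.

(** 3-cycles of a long interval are generated by those of its windows of length
    6: conjugation replaces the last entry of a 3-cycle, so a cycle through the
    new point [e] is obtained from a cycle through [e] and two points close to
    it. Five candidates leave one that avoids four given points. *)
Lemma windows_3cycles (M : int) (Q : int -> int -> int -> Prop) : 6 <= M ->
  (forall x y z, distinct3 x y z -> Q x y z -> Q y z x) ->
  (forall x y z k q, uniq [:: x; y; z; k; q] -> Q x y z -> Q z k q -> Q x y k) ->
  (forall p x y z, 0 <= p -> p + 6 <= M -> distinct3 x y z ->
    p <= x < p + 6 -> p <= y < p + 6 -> p <= z < p + 6 -> Q x y z) ->
  forall x y z, distinct3 x y z ->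
    0 <= x < M -> 0 <= y < M -> 0 <= z < M -> Q x y z.
Proof.
move=> M6 rot repl win.
suff H (b : nat) : b%:Z + 6 <= M -> forall x y z, distinct3 x y z ->
    0 <= x < b%:Z + 6 -> 0 <= y < b%:Z + 6 -> 0 <= z < b%:Z + 6 -> Q x y z.
  have bE : (absz (M - 6))%:Z + 6 = M by lia.
  by have := H `|M - 6|%N; rewrite bE; apply.
elim: b => [_ x y z d xM yM zM|b IH bM].
  by apply: (win 0) => //; lia.
have {}IH := IH ltac:(lia); pose e := b%:Z + 6; pose p := b%:Z + 1.
have pe a : p <= a < p + 5 -> 0 <= a < e by rewrite /p /e; lia.
have win6 a a' a'' : distinct3 a a' a'' -> p <= a <= e -> p <= a' <= e ->
    p <= a'' <= e -> Q a a' a''.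
  by move=> d ae a'e a''e; apply: (win p) => //; rewrite /p /e in ae a'e a''e *; lia.
have lte a : 0 <= a < e -> (e != a) * (a != e) by move=> ae; split; lia.
have sy (a a' : int) : a != a' -> a' != a by rewrite eq_sym.
have pw a : p <= a < p + 5 -> p <= a <= e by rewrite /p /e; lia.
have ew : p <= e <= e by rewrite /p /e; lia.
have last x y : x != y -> 0 <= x < e -> 0 <= y < e -> Q x y e.
  move=> xy xe ye; have xy' := sy _ _ xy.
  have [x' x'e /and4P[x'x x'y _ _]] := fresh4 p x y x y.
  have [y' y'e /and4P[y'x y'y y'x' _]] := fresh4 p x y x' x'.
  have [q qe /and4P[qx' qy' qy _]] := fresh4 p x' y' y y.
  have [q' q'e /and4P[q'y q'x' q'x _]] := fresh4 p y x' x x.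
  have [x'E y'E qE q'E] := And4 (pe _ x'e) (pe _ y'e) (pe _ qe) (pe _ q'e).
  have q1 : Q e x' y'.
    by apply: win6; rewrite ?ew ?pw // /distinct3 !lte // (sy _ _ y'x').
  have q2 : Q e x' y.
    apply: (repl _ _ y' y q) => //.
      by rewrite /= !inE !negb_or !lte // x'y y'y (sy _ _ y'x') (sy _ _ qx')
        (sy _ _ qy') (sy _ _ qy).
    by apply: IH; rewrite // /distinct3 y'y (sy _ _ qy) (sy _ _ qy').
  have q3 : Q y e x'.
    apply: (rot); first by rewrite /distinct3 !lte // x'y.
    by apply: (rot); first by rewrite /distinct3 !lte // x'y.
  have q4 : Q y e x.
    apply: (repl _ _ x' x q') => //.
      by rewrite /= !inE !negb_or !lte // (sy _ _ x'y) xy' (sy _ _ q'y) x'x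
        (sy _ _ q'x') (sy _ _ q'x).
    by apply: IH; rewrite // /distinct3 x'x (sy _ _ q'x) (sy _ _ q'x').
  apply: (rot); first by rewrite /distinct3 !lte // xy.
  by apply: (rot); first by rewrite /distinct3 !lte // xy'.
have e1 a : 0 <= a < b.+1%:Z + 6 -> a != e -> 0 <= a < e by rewrite /e; lia.
move=> x y z d xM yM zM; have [xy yz xz] := and3P d.
have [ze|ze] := eqVneq z e.
  by rewrite ze in yz xz *; apply: (last) => //; apply: e1.
have [xe|xe] := eqVneq x e.
  apply: (rot); first by rewrite /distinct3 (sy _ _ xz) xy (sy _ _ yz).
  apply: (rot); first by rewrite /distinct3 yz (sy _ _ xz) (sy _ _ xy).
  by rewrite xe in xy xz *; apply: (last) => //; apply: e1; rewrite // sy.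
have [ye|ye] := eqVneq y e.
  apply: (rot); first by rewrite /distinct3 (sy _ _ xz) xy (sy _ _ yz).
  by rewrite ye in xy yz *; apply: (last); [rewrite sy|apply: e1|apply: e1].
by apply: IH => //; apply: e1.
Qed.

Lemma cyc_conj_last x y u k q : uniq [:: x; y; u; k; q] ->
  (cyc u k q * cyc x y u * (cyc u k q)^-1 = cyc x y k)%g.
Proof.
rewrite /= !inE !negb_or !andbT.
move=> /and4P[/and4P[/eqP? /eqP? /eqP? /eqP?] /and3P[/eqP? /eqP? /eqP?]].
move=> /andP[/eqP? /eqP?] /eqP?; rewrite cycJ.
by rewrite /cyc !zpM !tpE; congr (tp _ _ * tp _ _)%g; case_eqs.
Qed.

Section FiniteGeneration.
Context (A : Type) (w : int -> A).
Context (lin : linear_complexity w) (sp : sparse_patterns w).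

Section Subgroup.
Context (K : set zperm) (sK : is_subgroup K).

Let K1 : K 1%g. Proof. by case: sK. Qed.
Let KM g h : K g -> K h -> K (g * h)%g. Proof. by case: sK => _ + _; apply. Qed.
Let KV g : K g -> K (g^-1)%g. Proof. by case: sK => _ _; apply. Qed.

Lemma sub_conj_last M E D x y u k q : sep M E -> D `<=` E ->
  uniq [:: x; y; u; k; q] -> 0 <= x < M -> 0 <= y < M -> 0 <= u < M ->
  0 <= k < M -> 0 <= q < M ->
  K (spread M D (cyc x y u)) -> K (spread M E (cyc u k q)) ->
  K (spread M D (cyc x y k)).
Proof.
move=> sE DE uq xM yM uM kM qM K1' K2.
rewrite -(cyc_conj_last uq) -(spreadJ sE DE (@subset_refl _ _)) //; try exact: supp_lt_cyc.
by apply: KM; [apply: KM|apply: KV].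
Qed.

Lemma sub_commg M E D1 D2 a b c y v : sep M E -> D1 `<=` E -> D2 `<=` E ->
  uniq [:: a; b; c; y; v] -> 0 <= a < M -> 0 <= b < M -> 0 <= c < M ->
  0 <= y < M -> 0 <= v < M ->
  K (spread M D1 (cyc c y b)) -> K (spread M D2 (cyc b a v)) ->
  K (spread M (D1 `&` D2) (cyc a b c)).
Proof.
move=> sE DE1 DE2 uq aM bM cM yM vM k1 k2.
rewrite -(cyc_commg uq) -(spread_commg sE) //; try exact: supp_lt_cyc.
by apply: KM; [apply: KM; [apply: KM|]|]; try apply: KV.
Qed.

Lemma sub_cover M r D al : sep M D -> supp_lt M al ->
  (forall v, K (spread M (D `&` pattern w r v) al)) -> K (spread M D al).
Proof.
move=> sD sa; apply: (cover_ind lin (P := fun B => K (spread M B al))).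
  by rewrite spread_set0.
by move=> B B' BD BD' BB KB KB'; rewrite (spreadU sD) //; apply: KM.
Qed.

End Subgroup.

Section Generators.
Context (R0 : nat) (s : seq int).
Context (sepR0 : forall v, sep 8 (pattern w R0 v)).
Context (sP : patterns_bound w R0.+2 s).

(** Patterns of radius [R0] are 8-separated; the two additional letters on each
    side let [good_base] apply to traces of translated patterns, and entries in
    [[1, 7)] leave the places 0 and 7 of the block free for translations. *)
Definition block_gens : set zperm := [set g | exists v x y z,
  [/\ v \in s, distinct3 x y z,
      [/\ 1 <= x < 7, 1 <= y < 7 & 1 <= z < 7]
    & g = spread 8 (pattern w R0.+2 v) (cyc x y z)]].

Let K := gen_set block_gens.
Let sK : is_subgroup K := gen_set_subgroup _.
Let K1 : K 1%g. Proof. by case: sK. Qed.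
Let KM g h : K g -> K h -> K (g * h)%g. Proof. by case: sK => _ + _; apply. Qed.
Let KV g : K g -> K (g^-1)%g. Proof. by case: sK => _ _; apply. Qed.

Lemma block_gens_finite : finite_set block_gens.
Proof.
pose l := [seq i%:Z | i <- iota 1 6].
have lP x : 1 <= x < 7 -> x \in l.
  by move=> x7; apply/mapP; exists `|x|%N; rewrite ?mem_iota; lia.
pose L := [seq spread 8 (pattern w R0.+2 t.1) (cyc t.2.1.1 t.2.1.2 t.2.2) |
  t <- [seq (v, t) | v <- s, t <- [seq (p, z) | p <- [seq (x, y) | x <- l, y <- l], z <- l]]].
apply: (@sub_finite_set _ _ [set` L]); last exact: finite_seq.
move=> _ [v [x [y [z [vs _ [/lP xl /lP yl /lP zl] ->]]]]].
apply/mapP; exists (v, ((x, y), z)) => //.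
by do !apply: allpairs_f.
Qed.

Let subP v D : D `<=` pattern w R0 v -> sep 8 D.
Proof. by move=> DE; exact: sepS (lexx _) DE (@sepR0 v). Qed.

Definition good (D : set int) := forall v x y z, distinct3 x y z ->
  1 <= x < 7 -> 1 <= y < 7 -> 1 <= z < 7 ->
  K (spread 8 (D `&` pattern w R0 v) (cyc x y z)).

Lemma good_pattern D v x y z : good D -> D `<=` pattern w R0 v ->
  distinct3 x y z -> 1 <= x < 7 -> 1 <= y < 7 -> 1 <= z < 7 ->
  K (spread 8 D (cyc x y z)).
Proof.
move=> gD Dv d x7 y7 z7; have := gD v x y z d x7 y7 z7.
rewrite (_ : D `&` _ = D) //; apply/seteqP; split=> [t []|t Dt] //.
by split; [|apply: Dv].
Qed.

Lemma good_base D : locset_at w R0.+2 D -> good D.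
Proof.
move=> lD v x y z d x7 y7 z7.
have sc : supp_lt 8 (cyc x y z) by apply: supp_lt_cyc; lia.
apply: (sub_cover sK (r := R0.+2)) => //; first by apply: (@subP v) => t [].
have lD' : locset_at w R0.+2 (D `&` pattern w R0 v).
  apply: locset_atI => //; apply: (@locset_le _ w R0); [lia|exact: locset_pattern].
move=> v'; have [->|->] := locset_pattern_sub v' lD'.
  by rewrite spread_set0.
have [u us uv'] := sP v'.
have -> : pattern w R0.+2 v' = pattern w R0.+2 u.
  by apply/seteqP; split=> t; apply: agree_trans => //; apply: agree_sym.
by move=> L [_]; apply; exists u, x, y, z.
Qed.

(** Two auxiliary entries write a 3-cycle as the commutator of two 3-cycles
    sharing one entry, one spread along [D] and the other along [D']. *)
Lemma goodI D D' : good D -> good D' -> good (D `&` D').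
Proof.
move=> gD gD' v x y z d x7 y7 z7.
have [p p7 /and4P[px py pz _]] := fresh4 1 x y z z.
have [q q7 /and4P[qx qy qz qp]] := fresh4 1 x y z p.
have -> : D `&` D' `&` pattern w R0 v =
    (D `&` pattern w R0 v) `&` (D' `&` pattern w R0 v).
  by rewrite setIACA setIid.
move: d; rewrite /distinct3 => d.
apply: (sub_commg sK (@sepR0 v) (y := p) (v := q)); try lia.
- by move=> t [].
- by move=> t [].
- by rewrite /= !inE; lia.
- by apply: gD; rewrite /distinct3; lia.
- by apply: gD'; rewrite /distinct3; lia.
Qed.

Lemma goodU D D' : D `&` D' = set0 -> good D -> good D' -> good (D `|` D').
Proof.
move=> DD gD gD' v x y z d x7 y7 z7.
have sc : supp_lt 8 (cyc x y z) by apply: supp_lt_cyc; lia.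
rewrite setIUl (spreadU (@sepR0 v)) //; try by move=> t [].
  by apply: KM; [apply: gD|apply: gD'].
by rewrite setIACA DD set0I.
Qed.

(** The block above a point of [D + s] is the block above the corresponding
    point of [D] with its entries moved by [s]; five of the six entries of the
    moved block already lie in the original one, and the sixth is reached by
    conjugation inside the generated subgroup. *)
Lemma good_shift (e : bool) D : good D ->
  good [set n | D (n + (if e then -1 else 1))].
Proof.
move=> gD v x y z d x7 y7 z7; pose t : int := if e then -1 else 1; rewrite -/t.
have sc : supp_lt 8 (cyc x y z) by apply: supp_lt_cyc; lia.
have te : `|t| = 1 by rewrite /t; case: (e).
apply: (sub_cover sK (r := R0.+1)) => //; first by apply: (@subP v) => ? [].
move=> v'; set F := _ `&` _.
have FE : F `<=` pattern w R0 v by move=> ? [[]].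
pose B := pattern w R0 v `&` pattern w R0.+1 v'.
have lB : locset_at w R0.+1 B.
  apply: locset_atI; last exact: locset_pattern.
  by apply: (@locset_le _ w R0); [lia|exact: locset_pattern].
have gB : good B by apply: good_base; apply: locset_le lB; lia.
pose C := [set n | B (n - t)].
have CE : C `<=` pattern w R0 (v' + t).
  move=> n [_ nv']; rewrite /pattern /= -(subrK t n).
  by apply: agree_shift nv'; lia.
have gC : good C.
  apply: good_base; have := @locset_shift_at _ w _ (- t) _ lB.
  by apply: locset_le; lia.
have gDC := goodI gD gC.
have FB n : F n <-> (D `&` C) (n + t).
  rewrite /F /C /B /= addrK; split; first by move=> [[? ?] ?].
  by move=> [? [? ?]].
have BC n : B n <-> C (n + t) by rewrite /C /= addrK.
have sC : sep 8 C by apply: subP CE.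
have sDC : sep 8 (D `&` C) by apply: (sepS (lexx _) _ sC) => ? [].
have Kx a b c : distinct3 a b c -> 1 <= a + t < 7 -> 1 <= b + t < 7 ->
    1 <= c + t < 7 -> 0 <= a < 8 -> 0 <= b < 8 -> 0 <= c < 8 ->
    K (spread 8 C (cyc a b c)).
  move=> dd a7 b7 c7 a8 b8 c8.
  have dd' : distinct3 (a + t) (b + t) (c + t).
    by move: dd; rewrite /distinct3; lia.
  have -> : spread 8 C (cyc a b c) = spread 8 B (cyc (a + t) (b + t) (c + t)).
    have := @spread_shift 8 8 C B (- t) (a + t) (b + t) (c + t).
    rewrite !addrK => -> //; try lia; first by apply: (@subP v) => ? [].
    by move=> n; rewrite BC opprK.
  by apply: (good_pattern (v := v) gB) => // ? [].
have Ky a b c : distinct3 a b c -> 1 <= a < 7 -> 1 <= b < 7 -> 1 <= c < 7 ->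
    K (spread 8 (D `&` C) (cyc a b c)).
  by move=> dd a7 b7 c7; apply: (good_pattern gDC) => // ? [_ /CE]; apply.
pose p := if e then 2 else 1 : int; pose k := if e then 7 else 0 : int.
have tpk : (t = -1 /\ p = 2 /\ k = 7) \/ (t = 1 /\ p = 1 /\ k = 0).
  by rewrite /t /p /k; case: (e); [left|right].
move: p k tpk => p k tpk {te}.
have Kk a b : a != b -> p <= a < p + 5 -> p <= b < p + 5 ->
    K (spread 8 (D `&` C) (cyc a b k)).
  move=> ab ap bp.
  have [u up /and4P[ua ub _ _]] := fresh4 p a b a b.
  have [q qp /and4P[qa qb qu _]] := fresh4 p a b u u.
  apply: (sub_conj_last sK sC (u := u) (q := q)); try lia.
  - by move=> ? [].
  - by rewrite /= !inE; lia.
  - by apply: Ky; rewrite ?/distinct3; lia.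
  - by apply: Kx; rewrite ?/distinct3; lia.
have -> : spread 8 F (cyc x y z) =
    spread 8 (D `&` C) (cyc (x - t) (y - t) (z - t)).
  rewrite (@spread_shift 8 8 (D `&` C) F (- t)) //; try lia; first exact: subP FE.
  by move=> n; rewrite FB opprK.
have d' : distinct3 (x - t) (y - t) (z - t) by move: d; rewrite /distinct3; lia.
have [zk|zk] := eqVneq (z - t) k.
  by rewrite zk; apply: Kk; rewrite /distinct3 in d'; lia.
have [yk|yk] := eqVneq (y - t) k.
  rewrite cyc_rot // cyc_rot ?yk; last by rewrite /distinct3 in d' *; lia.
  by apply: Kk; rewrite /distinct3 in d'; lia.
have [xk|xk] := eqVneq (x - t) k.
  rewrite cyc_rot ?xk; last by rewrite /distinct3 in d' *; lia.
  by apply: Kk; rewrite /distinct3 in d'; lia.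
by apply: Ky => //; lia.
Qed.

(** A pattern of radius [r + 1] is the intersection of three patterns of radius
    [r], centred at neighbouring integers. *)
Lemma good_local r D : locset_at w r D -> good D.
Proof.
elim: r D => [|r IH] D lD; first by apply: good_base; apply: locset_le lD.
apply: (cover_ind lin (r := r.+1)) => [|B B' _ _|v]; last 1 first.
- have [->|->] := locset_pattern_sub v lD; first by apply: good_base => ? ? ? [].
  pose sh (e : bool) : int := if e then -1 else 1.
  have -> : pattern w r.+1 v = pattern w r v `&`
      ([set n | pattern w r (v + sh false) (n + sh false)] `&`
       [set n | pattern w r (v + sh true) (n + sh true)]).
    apply/seteqP; split=> n.
      move=> vn; split; first exact: agree_le vn.
      by split; rewrite /pattern /=; apply: agree_shift vn; rewrite /sh; lia.
    move=> [vn [vn1 vn2]] i ir.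
    have [i1|i1] := boolP (1 <= i).
      have := vn1 (i - 1); rewrite /sh -!addrA (_ : 1 + (i - 1) = i); last lia.
      by apply; lia.
    have [i2|i2] := boolP (i <= -1).
      have := vn2 (i + 1); rewrite /sh -!addrA (_ : -1 + (i + 1) = i); last lia.
      by apply; lia.
    by apply: vn; lia.
  apply: goodI; first by apply: IH; apply: locset_pattern.
  have gs e : good [set n | pattern w r (v + sh e) (n + sh e)].
    by apply: good_shift; apply: IH; apply: locset_pattern.
  by apply: goodI; apply: gs.
- by apply: good_base => ? ? ? [].
- exact: goodU.
Qed.

(** On a sufficiently separated piece of its base set, a 3-cycle with entries in
    a window of length 6 is, up to a translation, a 3-cycle of the blocks of
    length 8. *)
Lemma three_cycles_blocks : three_cycles w `<=` K.
Proof.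
move=> _ [M [D [x [y [z [[r lD] sD d [xM yM zM] ->]]]]]].
have [r' sr'] := sp (M + 8).
apply: (sub_cover sK (r := r')) => [//||v]; first exact: supp_lt_cyc.
set D' := D `&` _.
have sD' : sep (M + 8) D'.
  by apply: sepS (lexx _) _ (sr' v) => ? [].
have lD' : locset_at w (maxn r r') D'.
  apply: locset_atI; first by apply: locset_le lD; lia.
  by apply: (@locset_le _ w r'); [lia|exact: locset_pattern].
have MM : M <= M + 8 by lia.
rewrite (spread_widen MM) //; last exact: supp_lt_cyc.
pose Q a b c := [/\ 0 <= a < M + 8, 0 <= b < M + 8, 0 <= c < M + 8
  & K (spread (M + 8) D' (cyc a b c))].
suff : Q x y z by case.
apply: (windows_3cycles (M := M + 8)) => //; try lia.
- by move=> a b c dd [? ? ?]; rewrite cyc_rot.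
- move=> a b c k q uq [? ? ? K3] [? ? ? K4]; split=> //.
  exact: (sub_conj_last sK sD' _ uq _ _ _ _ _ K3 K4).
move=> p a b c p0 pM dd ap bp cp; split; try lia.
pose D2 := [set n | D' (n + (1 - p))].
have sD2 : sep 8 D2.
  move=> n n' Dn Dn' nn.
  by have : n + (1 - p) = n' + (1 - p); [apply: sD' => //; lia|lia].
have gD2 : good D2 by apply: (good_local (locset_shift_at lD')).
rewrite (@spread_shift (M + 8) 8 D2 D' (1 - p)) //; try lia; last first.
  by move=> n; rewrite /D2 /= subrK.
apply: (sub_cover sK (r := R0)) => [//||u]; first by apply: supp_lt_cyc; lia.
by apply: gD2; try lia; move: dd; rewrite /distinct3; lia.
Qed.

End Generators.

Theorem three_cycles_fg : finitely_generated (generated (three_cycles w)).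
Proof.
have [R0 sR0] := sp 8; have [C /(_ R0.+2) [s _ sP]] := lin.
apply: (@generated_finite _ _ (block_gens R0 s)).
- exact: block_gens_finite.
- move=> _ [v [x [y [z [vs d [x7 y7 z7] ->]]]]] L [_]; apply.
  exists 8, (pattern w R0.+2 v), x, y, z; split=> //; last by split; lia.
    by exists R0.+2; exact: locset_pattern.
  by apply: sepS (lexx _) _ (sR0 v) => n; apply: agree_le; lia.
- exact: three_cycles_blocks.
Qed.

End FiniteGeneration.

(** * Simplicity *)

Definition supported (V : set int) (g : zperm) := forall m, g m <> m -> V m.

Lemma disjoint_commute (V W : set int) (g h : zperm) :
  supported V g -> supported W h -> V `&` W = set0 -> (g * h = h * g)%g.
Proof.
move=> gV hW VW; have dis m : g m <> m -> h m <> m -> False.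
  by move=> /gV Vm /hW Wm; have : (V `&` W) m by []; rewrite VW.
apply: zpermP => m; rewrite !zpM.
have [hm|hm] := pselect (h m = m).
  have [gm|gm] := pselect (g m = m); first by rewrite hm gm hm.
  rewrite hm; symmetry; apply: contrapT => hgm; apply: (dis (g m)) => //.
  by move/zp_inj.
have [gm|gm] := pselect (g m = m); last by case: (dis m).
rewrite gm; apply: contrapT => ghm; apply: (dis (h m)) => //.
by move/zp_inj.
Qed.

Lemma supportedV V (g : zperm) : supported V g -> supported V (g^-1)%g.
Proof. by move=> gV m gm; apply: gV => gm'; apply: gm; rewrite -{1}gm' zpK. Qed.

Lemma supportedJ (V : set int) (g h : zperm) : supported V h ->
  supported [set m | V ((g^-1)%g m)] (g * h * g^-1)%g.
Proof.
move=> hV m; rewrite !zpM => hm; apply: hV => e; apply: hm.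
by rewrite e zpKV.
Qed.

Lemma supportedM V (g h : zperm) : supported V g -> supported V h -> supported V (g * h)%g.
Proof.
move=> gV hV m; rewrite zpM => ghm.
have [hm|] := pselect (h m = m); last exact: hV.
by apply: gV; rewrite -[in X in X <> _]hm.
Qed.

(** When [g] moves [V] off itself, the commutator with [g] turns any element
    supported in [V] into its inverse on [V] times something elsewhere, so a
    double commutator forgets [g]. *)
Lemma double_commutator (V : set int) (g t1 t2 : zperm) :
  (forall m, V m -> ~ V (g m)) -> supported V t1 -> supported V t2 ->
  let c := (g * t1 * g^-1 * t1^-1)%g in
  (c * (t2 * c^-1 * t2^-1) = t1^-1 * t2 * t1 * t2^-1)%g.
Proof.
move=> gV s1 s2 /=; set a := (g * t1 * g^-1)%g.
have sa : supported [set m | V ((g^-1)%g m)] a by apply: supportedJ.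
have VV : [set m | V ((g^-1)%g m)] `&` V = set0.
  by rewrite -subset0 => m [/gV]; rewrite zpKV.
have su : supported V (t1^-1 * t2 * t1)%g.
  by do !apply: supportedM => //; apply: supportedV.
have com := disjoint_commute sa su VV.
transitivity (a * (t1^-1 * t2 * t1) * a^-1 * t2^-1)%g.
  by rewrite invgM invgK !mulgA.
by rewrite com mulgK.
Qed.

Section Simple.
Context (A : Type) (w : int -> A).
Context (lin : linear_complexity w) (sp : sparse_patterns w) (rc : recurrent w).

Let S := three_cycles w.
Let H := gen_set S.

Section Normal.
Context (N : set zperm) (sN : is_subgroup N) (NH : N `<=` H).
Context (nN : forall g x, H g -> N x -> N (g * x * g^-1)%g).

Let NM g h : N g -> N h -> N (g * h)%g. Proof. by case: sN => _ + _; apply. Qed.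
Let NV g : N g -> N (g^-1)%g. Proof. by case: sN => _ _; apply. Qed.
Let HV g : H g -> H (g^-1)%g.
Proof. by have [_ _ +] := gen_set_subgroup S; apply. Qed.

Lemma normal_conj_last M D x y u k q : sep M D -> locset w D ->
  uniq [:: x; y; u; k; q] -> 0 <= x < M -> 0 <= y < M -> 0 <= u < M ->
  0 <= k < M -> 0 <= q < M ->
  N (spread M D (cyc x y u)) -> N (spread M D (cyc x y k)).
Proof.
move=> sD lD uq xM yM uM kM qM Nx.
have s1 := supp_lt_cyc xM yM uM; have s2 := supp_lt_cyc uM kM qM.
rewrite -(cyc_conj_last uq).
rewrite -(spreadJ sD (@subset_refl _ D) (@subset_refl _ D) s1 s2).
apply: nN => // L [_]; apply; exists M, D, u, k, q; split=> //.
by move: uq; rewrite /= !inE /distinct3; lia.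
Qed.

(** All the points of a long enough pattern around [v0] are moved by the same
    amount [g v0 - v0], hence off the pattern since it is sparse. *)
Lemma normal_commutators g v0 : N g -> g v0 <> v0 -> exists R,
  forall t1 t2, H t1 -> H t2 -> supported (pattern w R v0) t1 ->
    supported (pattern w R v0) t2 -> N (t1 * t2 * t1^-1 * t2^-1)%g.
Proof.
move=> Ng gv; have [r lg] := three_cycles_locperm lin (NH Ng).
have [r' sr'] := sp (`|g v0 - v0| + 1).
exists (maxn r r') => t1 t2 H1 H2 s1 s2.
have gV m : pattern w (maxn r r') v0 m -> ~ pattern w (maxn r r') v0 (g m).
  move=> vm vgm; have gm : g m = g v0 + (m - v0).
    by apply: lg; apply: agree_le vm; lia.
  have : m = g m; last by lia.
  apply: (sr' v0); [apply: agree_le vm|apply: agree_le vgm|]; lia.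
have Hi1 := HV H1; have si1 := supportedV s1.
rewrite -[t1 in X in (X * t2)%g]invgK -(double_commutator gV si1 s2).
have Nc : N (g * t1^-1 * g^-1 * t1^-1^-1)%g.
  rewrite -!mulgA; apply: NM => //; rewrite mulgA; apply: nN => //.
  exact: NV.
by apply: NM => //; apply: nN => //; exact: NV.
Qed.

(** By recurrence, translates of any small piece of a local set by suitable
    integers [q 0, .., q 4] lie in the pattern of [normal_commutators]. The
    3-cycle on three of these translates is a commutator, and its entries are then
    replaced one at a time by the wanted ones. *)
Lemma normal_three_cycles g v0 : N g -> g v0 <> v0 -> S `<=` N.
Proof.
move=> Ng gv; have [R NR] := normal_commutators Ng gv.
have [p p0 pP] := rc R v0.
move=> _ [M [D [x [y [z [[r lD] sD d [xM yM zM] ->]]]]]].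
have M0 : 0 < M by lia.
have pM : M <= p * M by nia.
pose M' : int := p * (M + 5).
have MM' : M <= M' by rewrite /M'; nia.
have [r' sr'] := sp M'.
pose r2 := maxn r' (R + `|M'|).
apply: (sub_cover lin sN (r := r2)) => // [|v]; first exact: supp_lt_cyc.
set D' := D `&` _.
have sD' : sep M' D'.
  by apply: sepS (lexx _) _ (sr' v) => n [_]; apply: agree_le; rewrite /r2; lia.
have lD' : locset w D'.
  by apply: locsetI; [exists r|exists r2; exact: locset_pattern].
rewrite (spread_widen MM') //; last exact: supp_lt_cyc.
(* [v + q j] lies in [v0 + p Z], and [q j] outside the block [[0, M)]. *)
pose q (j : int) : int := ((v0 - v) %% p)%Z + p * (M + j).
have modp : 0 <= ((v0 - v) %% p)%Z < p.
  by rewrite modz_ge0 ?ltz_pmod //; lia.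
have qM (j : int) : 0 <= j < 5 -> M <= q j < M' by rewrite /q /M' => j5; nia.
have qM' (j : int) : 0 <= j < 5 -> 0 <= q j < M' by move/qM; lia.
have qI (i j : int) : i < j -> q i < q j by rewrite /q => ij; nia.
have q01 := qI 0 1 isT; have q12 := qI 1 2 isT; have q23 := qI 2 3 isT.
have q34 := qI 3 4 isT.
have q0 := qM 0 isT; have q1 := qM 1 isT; have q2 := qM 2 isT.
have q3 := qM 3 isT; have q4 := qM 4 isT.
have qV (j n : int) : 0 <= j < 5 -> D' n -> pattern w R v0 (n + q j).
  move=> j5 [_ vn]; apply: (agree_trans (n' := v + q j)).
    have -> : v + q j = v0 + (M + j - ((v0 - v) %/ p)%Z) * p.
      by rewrite /q; have := divz_eq (v0 - v) p; lia.
    exact: pP.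
  by apply: agree_shift vn; rewrite /r2; have := qM _ j5; lia.
clearbody q M'; clear modp.
have supq (i j k : int) : 0 <= i < 5 -> 0 <= j < 5 -> 0 <= k < 5 ->
    distinct3 (q i) (q j) (q k) ->
    supported (pattern w R v0) (spread M' D' (cyc (q i) (q j) (q k))).
  move=> i5 j5 k5 dd m mm; apply: contrapT => nVm; apply: mm.
  have [_ _ _ ->] // := spread_cycE m sD' dd (qM' _ i5) (qM' _ j5) (qM' _ k5).
  - by move=> /(qV _ _ i5); rewrite subrK.
  - by move=> /(qV _ _ j5); rewrite subrK.
  - by move=> /(qV _ _ k5); rewrite subrK.
have Hq (i j k : int) : 0 <= i < 5 -> 0 <= j < 5 -> 0 <= k < 5 ->
    distinct3 (q i) (q j) (q k) -> H (spread M' D' (cyc (q i) (q j) (q k))).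
  move=> i5 j5 k5 dd L [_]; apply; exists M', D', (q i), (q j), (q k).
  by split=> //; split; apply: qM'.
have d3 a b c : distinct3 a b c = [&& a != b, b != c & a != c] by [].
have N1 : N (spread M' D' (cyc (q 0) (q 1) (q 2))).
  have uq : uniq [:: q 0; q 1; q 2; q 3; q 4] by rewrite /= !inE; lia.
  rewrite -(cyc_commg uq) -[X in spread _ X](setIid D').
  rewrite -(spread_commg sD') //; try (apply: supp_lt_cyc; lia).
  have dd1 : distinct3 (q 2) (q 3) (q 1) by rewrite d3; lia.
  have dd2 : distinct3 (q 1) (q 0) (q 4) by rewrite d3; lia.
  by apply: NR; [exact: Hq|exact: Hq|exact: supq|exact: supq].
move: d; rewrite d3 => d.
have N2 : N (spread M' D' (cyc (q 0) (q 1) z)).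
  apply: (@normal_conj_last _ _ _ _ (q 2) _ (q 3)) => //; try lia.
  by rewrite /= !inE; lia.
have N3 : N (spread M' D' (cyc z (q 0) y)).
  apply: (@normal_conj_last _ _ _ _ (q 1) _ (q 3)) => //; try lia.
    by rewrite /= !inE; lia.
  by rewrite cyc_rot ?d3 //; lia.
have N4 : N (spread M' D' (cyc y z x)).
  apply: (@normal_conj_last _ _ _ _ (q 0) _ (q 3)) => //; try lia.
    by rewrite /= !inE; lia.
  by rewrite cyc_rot ?d3 //; lia.
by rewrite cyc_rot ?d3 //; lia.
Qed.

End Normal.

Theorem three_cycles_simple : simple_group (generated S).
Proof.
have [S1 SM SV] := gen_set_subgroup S; split.
  have [r sr] := sp 3; pose g := spread 3 (pattern w r 0) (cyc 0 1 2).
  have Sg : gen_set S g.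
    move=> L [_]; apply; exists 3, (pattern w r 0), 0, 1, 2; split=> //.
    by exists r; exact: locset_pattern.
  exists (Sub g (mem_set Sg) : generated S) => /(congr1 val) /= g1.
  have [] := @spread_cycE 3 (pattern w r 0) 0 1 2 0 (sr 0) isT isT isT isT.
  by rewrite -/g => + _ _ _; rewrite g1 zp1 subr0 => /(_ (@agree_refl _ _ _ _)).
move=> N [[N1 NM NV] nN].
have [[x Nx x1]|Ntriv] := pselect (exists2 x, N x & x <> 1%g); last first.
  left; apply/seteqP; split=> x; last by move=> ->.
  by move=> Nx; apply: contrapT => x1; apply: Ntriv; exists x.
right; apply/seteqP; split=> // h _.
pose N' : set zperm := [set val x | x in N].
have sN' : is_subgroup N'.
  split; first by exists 1%g.
    by move=> _ _ [a Na <-] [b Nb <-]; exists (a * b)%g => //; exact: NM.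
  by move=> _ [a Na <-]; exists (a^-1)%g => //; exact: NV.
have N'H : N' `<=` gen_set S.
  by move=> _ [a _ <-]; have := valP a; rewrite inE.
have nN' g y : gen_set S g -> N' y -> N' (g * y * g^-1)%g.
  move=> Sg [a Na <-]; pose k : generated S := Sub g (mem_set Sg).
  exists (a ^ (k^-1))%g; first exact: nN.
  by rewrite conjgE invgK mulgA.
have [v xv] : exists v, val x v <> v.
  apply: contrapT => nv; apply: x1; apply: val_inj; apply: zpermP => v.
  by apply: contrapT => xv; apply: nv; exists v.
have SN' : S `<=` N'.
  by apply: (normal_three_cycles sN' N'H nN' (g := val x) _ xv); exists x.
have : gen_set S (val h) by have := valP h; rewrite inE.
by move=> /(_ N') [] // a Na /val_inj <-.
Qed.

End Simple.

(** * A Toeplitz sequence of linear complexity *)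

Definition val2 (y : int) : nat := logn 2 `|y|%N.

Lemma val2_mul (s : nat) (z : int) : val2 (2 ^+ s * (2 * z + 1)) = s.
Proof.
rewrite /val2 abszM lognM; first last.
- by lia.
- by rewrite abszX expn_gt0.
rewrite abszX pfactorK // (_ : logn 2 _ = 0%N) ?addn0 //.
rewrite lognE; case: ifP => // /and3P[_ _]; lia.
Qed.

Lemma val2P (y : int) : y != 0 -> exists z, y = 2 ^+ val2 y * (2 * z + 1).
Proof.
move=> y0; have y0' : (0 < `|y|)%N by lia.
have [m m2 yE] := pfactor_coprime (isT : prime 2) y0'.
have [k mk] : exists k, m = k.*2.+1.
  exists m./2; rewrite -[m in LHS]odd_double_half.
  by move: m2; rewrite coprime2n => ->.
have yZ : `|y| = 2 ^+ val2 y * (2 * k%:Z + 1).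
  rewrite -abszE [in LHS]yE mulnC PoszM -[Posz (2 ^ _)]natz natrX mk.
  by congr (_ * _); lia.
have [y1|y1] := boolP (0 <= y); first by exists k%:Z; rewrite -yZ; lia.
by exists (- k%:Z - 1); rewrite (_ : _ * _ = - `|y|); [lia|rewrite yZ; lia].
Qed.

Lemma val2_add (y m : int) (K : nat) : y != 0 -> (val2 y < K)%N ->
  val2 (y + m * 2 ^+ K) = val2 y.
Proof.
move=> /val2P[z]; set s := val2 y => -> sK.
have -> : K = (s + (K - s.+1).+1)%N by lia.
rewrite exprD exprS.
transitivity (val2 (2 ^+ s * (2 * (z + m * 2 ^+ (K - s.+1)) + 1))).
  by congr val2; ring.
by rewrite !val2_mul.
Qed.

Lemma val2_lt (y : int) (K : nat) : y != 0 -> `|y| < 2 ^+ K -> (val2 y < K)%N.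
Proof.
move=> y0 yK; rewrite -(ltn_exp2l _ _ (isT : (1 < 2)%N)).
apply: (@leq_ltn_trans `|y|%N); last first.
  by rewrite -ltz_nat -[Posz (2 ^ _)]natz natrX abszE.
by apply: dvdn_leq; [lia|apply: pfactor_dvdnn].
Qed.

Lemma val2_ge (y : int) (K : nat) : y != 0 -> ~~ (val2 y < K)%N ->
  exists m, y = 2 ^+ K * m.
Proof.
move=> /val2P[z ->]; rewrite val2_mul -leqNgt; set s := val2 y => Ks.
exists (2 ^+ (s - K) * (2 * z + 1)).
by rewrite mulrA -exprD subnKC.
Qed.

(** 3 is invertible modulo powers of 2, one more binary digit at each step. *)
Lemma solve3 (e : nat) (c : int) : exists i m : int, 0 <= i < 2 ^+ e /\ 3 * i = c + m * 2 ^+ e.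
Proof.
elim: e => [|e [i [m [ie im]]]].
  by exists 0, (- c); split=> //; rewrite expr0; lia.
have [m2|m2] := boolP (2 %| m)%Z.
  exists i, (m %/ 2)%Z; rewrite exprS mulrA divzK //; split=> //; lia.
exists (i + 2 ^+ e), ((m + 3) %/ 2)%Z; rewrite exprS mulrA divzK; last by lia.
split; [lia|by rewrite mulrDr im; ring].
Qed.

Section Toeplitz.
Context (T : finType) (l : nat -> T).

(** [3 * n + 8] never vanishes, so there is no singular position and each value is
    repeated periodically. For even [n] it is [2 * (coord n + 3)], which
    gives the label of an edge of the line. *)
Definition toeplitz (n : int) : T := l (val2 (3 * n + 8)).

(** The valuations met in a pattern are bounded by some [K]; the translation by
    [2 ^ K] preserves all of them. *)
Lemma toeplitz_recurrent : recurrent toeplitz.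
Proof.
move=> r v; pose K := (absz (3 * v)%R + 3 * r + 9)%N.
exists (2 ^+ K); first by rewrite exprn_gt0.
move=> k i ir; rewrite /toeplitz; congr l.
rewrite (_ : 3 * (v + k * _ + i) + 8 = (3 * (v + i) + 8) + 3 * k * 2 ^+ K); last by ring.
rewrite val2_add //; first by lia.
apply: val2_lt; first by lia.
have := ltn_expl K (isT : (1 < 2)%N); rewrite -ltz_nat -natrX natz.
by rewrite /K; lia.
Qed.

(** Two equal patterns at a small distance [t] disagree at a position whose
    valuation is that of [t]: there, adding [3 t] raises the valuation by exactly
    one. *)
Lemma toeplitz_sparse : (forall k, l k <> l k.+1) -> sparse_patterns toeplitz.
Proof.
move=> lS M.
(* The wanted position is known modulo [2 ^ s.+2], where [2 ^ s] divides a
   nonzero integer smaller than [M]. *)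
exists (4 * `|M|)%N => v n n' vn vn' nM.
apply: contrapT => nn'; pose t : int := n' - n.
have t0 : t != 0 by rewrite /t; lia.
have [z tE] := val2P t0; move: tE; set s := val2 t => tE.
have [i [m [i4 im]]] := solve3 s.+2 (3 * t - 3 * n - 8).
have sM : (2 ^+ s.+2 : int) <= 4 * `|M|.
  have : (2 ^ s <= `|t|)%N.
    by rewrite dvdn_leq // ?pfactor_dvdnn // absz_gt0.
  rewrite -lez_nat -[Posz (2 ^ s)]natz natrX natz 2!exprS /t; lia.
have e1 : 3 * (n + i) + 8 = 2 ^+ s * (2 * (3 * z + 1 + 2 * m) + 1).
  have -> : 3 * (n + i) + 8 = 3 * t + m * 2 ^+ s.+2 by lia.
  by rewrite tE 2!exprS; ring.
have e2 : 3 * (n' + i) + 8 = 2 ^+ s.+1 * (2 * (3 * z + 1 + m) + 1).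
  have -> : 3 * (n' + i) + 8 = 3 * (n + i) + 8 + 3 * t by rewrite /t; lia.
  by rewrite e1 tE exprS; ring.
apply: (lS s); have : agree toeplitz (4 * `|M|) n n'.
  exact: agree_trans (agree_sym vn) vn'.
move=> /(_ i); rewrite /toeplitz e1 e2 !val2_mul; apply; lia.
Qed.

Lemma key_reps (K : finType) (key : int -> K) :
  exists2 s : seq int, size s = #|K| & forall n, exists2 v, v \in s & key v = key n.
Proof.
exists [seq xget 0 [set n | key n = k] | k <- enum K].
  by rewrite size_map -cardE.
move=> n; exists (xget 0 [set v | key v = key n]).
  by apply/mapP; exists (key n); rewrite ?mem_enum.
by case: xgetP => [v _ //|/(_ n) []].
Qed.

(** A pattern shorter than [2 ^ j] is determined by the residue of its centre
    modulo [2 ^ j], except for at most one letter. *)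
Lemma toeplitz_linear : linear_complexity toeplitz.
Proof.
exists (4 * #|T|.+1)%N => r.
pose j := (trunc_log 2 (2 * r + 1)).+1.
have j1 : (2 * r + 1 < 2 ^ j)%N by apply: trunc_log_ltn.
have j2 : (2 ^ j <= 4 * r.+1)%N.
  have := @trunc_logP 2 (2 * r + 1) isT ltac:(lia).
  by rewrite /j expnS; lia.
have j0 : (0 < 2 ^ j)%N by rewrite expn_gt0.
have pE : (2 ^ j)%N%:Z = 2 ^+ j :> int by rewrite -[LHS]natz natrX natz.
have j1Z : 2 * r%:Z + 1 < 2 ^+ j by rewrite -pE; lia.
pose special n : set int := [set i | `|i| <= r%:Z /\
  exists m, 3 * (n + i) + 8 = 2 ^+ j * m].
have special_uniq n i i' : special n i -> special n i' -> i = i'.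
  move=> [ir [m im]] [ir' [m' im']].
  have : (2 ^+ j %| 3 * (i - i'))%Z.
    by apply/dvdzP; exists (m - m'); rewrite [RHS]mulrC [RHS]mulrBr -im -im'; ring.
  rewrite Gauss_dvdzr; last first.
    by rewrite -pE coprimezE coprimeXl.
  move=> /dvdzP[q qE]; have [q0|q0] := eqVneq q 0; first by rewrite q0 in qE; lia.
  have : `|i - i'| < 2 ^+ j by lia.
  by rewrite qE normrM gtr0_norm ?exprn_gt0 //; nia.
pose key n : 'I_(2 ^ j).-1.+1 * option T :=
  (inord `|(n %% (2 ^ j)%N)%Z|%N,
   if `[< exists i, special n i >] then Some (toeplitz (n + xget 0 (special n)))
   else None).
have [s sz sP] := key_reps key; exists s.
  rewrite sz card_prod card_ord card_option prednK //.
  by rewrite mulnAC leq_mul.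
move=> n; have [v vs [vn sn]] := sP n; exists v => //.
have [q nE] : exists q, n = v + q * 2 ^+ j.
  exists ((n %/ 2 ^+ j)%Z - (v %/ 2 ^+ j)%Z).
  have m0 (u : int) : 0 <= (u %% (2 ^ j)%N)%Z < (2 ^ j)%N.
    by rewrite modz_ge0 ?ltz_pmod //; lia.
  have : (v %% 2 ^+ j)%Z = (n %% 2 ^+ j)%Z.
    rewrite -pE; have := m0 v; have := m0 n; move/(congr1 val): vn => /=.
    rewrite !inordK ?prednK //; have := m0 v; have := m0 n; lia.
  have := divz_eq n (2 ^+ j); have := divz_eq v (2 ^+ j).
  by rewrite mulrBl; lia.
have yE i : 3 * (n + i) + 8 = 3 * (v + i) + 8 + 3 * q * 2 ^+ j.
  by rewrite nE; ring.
move=> i ir; rewrite /toeplitz.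
have y0 : 3 * (v + i) + 8 != 0 by lia.
have [vj|vj] := boolP (val2 (3 * (v + i) + 8) < j)%N.
  by rewrite yE val2_add.
have [m mE] := val2_ge y0 vj.
have spv : special v i by split=> //; exists m.
have spn : special n i by split=> //; exists (m + 3 * q); rewrite yE mE; ring.
move: sn; rewrite !asboolT; try by exists i.
case; rewrite /toeplitz.
case: xgetP => [i1 _ /(special_uniq _ _ _ spv) <-|/(_ i)//].
by case: xgetP => [i2 _ /(special_uniq _ _ _ spn) <-|/(_ i)//].
Qed.

End Toeplitz.

(** * Embedding the Grigorchuk groups *)

Lemma embeds_in_morph (G H : groupType) (f : G -> H) :
  {morph f : x y / (x * y)%g} -> injective f -> embeds_in G H.
Proof.
move=> fM fI; pose m := isMultiplicative.Build G H f fM.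
by exists (HB.pack_for {multiplicative G -> H} f m).
Qed.

Lemma val2_double (y : int) : y != 0 -> val2 (2 * y) = (val2 y).+1.
Proof. by move=> /val2P[z] ->; rewrite mulrA -exprS !val2_mul. Qed.

Lemma val2_odd (y : int) : ~~ (2 %| y)%Z -> val2 y = 0%N.
Proof.
move=> y2; rewrite (_ : y = 2 ^+ 0 * (2 * (y %/ 2)%Z + 1)) ?val2_mul //.
by rewrite expr0; lia.
Qed.

(** [halve] is the 2-adic shift [t |-> floor (t / 2)] for [t = u / 3]. *)
Definition halve (u : int) : int :=
  if (2 %| u)%Z then (u %/ 2)%Z else ((u - 3) %/ 2)%Z.

(** The prefix of length [m] of the ray with index [t = u / 3], a 2-adic integer:
    the letters tell whether consecutive binary digits of [t] agree. Adding 1 to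
    [t], that is 3 to [u], changes a single letter. *)
Fixpoint gray (m : nat) (u : int) : vertex :=
  if m is m'.+1 then ((u %% 4)%Z < 2) :: gray m' (halve u) else [::].

(** Only pairs of consecutive points are exchanged: [u] even and [u + 3] by [a],
    and [u] odd and [u + 3] by those of [b], [c], [d] that the valuation of
    [u + 3] allows. *)
Definition line_a (u : int) : int := if (2 %| u)%Z then u + 3 else u - 3.

Definition line_bcd (i : 'I_3) (omega : Omega) (u : int) : int :=
  if (2 %| u)%Z then (if omega (val2 u).-1 != i then u - 3 else u)
  else (if omega (val2 (u + 3)).-1 != i then u + 3 else u).

Lemma gray_a m u : gray m (line_a u) = a_fun (gray m u).
Proof.
case: m => //= m; have e : halve (line_a u) = halve u.
  by rewrite /halve /line_a; do !case: ifP; lia.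
by rewrite e /line_a; congr (_ :: _); case: ifP; lia.
Qed.

(** A letter 1 shifts both [omega] and the valuation; at the first letter 0 the
    valuation is 1 and the rest of the word is modified by [a] or kept. *)
Lemma gray_bcd i m omega u : ~~ (3 %| u)%Z ->
  gray m (line_bcd i omega u) = bcd_fun i omega (gray m u).
Proof.
elim: m omega u => [//|m IH] omega u u3.
have h3 : ~~ (3 %| halve u)%Z by rewrite /halve; case: ifP; lia.
have u0 : u != 0 by lia.
have u30 : u + 3 != 0 by lia.
rewrite [gray m.+1 u]/=; have [u1|u1] := boolP ((u %% 4)%Z < 2).
  rewrite [bcd_fun _ _ _]/= -IH // [LHS]/=; congr (_ :: gray m _).
    by rewrite /line_bcd; do !case: ifP; lia.
  have [u2|u2] := boolP (2 %| u)%Z.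
    have hE : halve u = (u %/ 2)%Z by rewrite /halve u2.
    have vE : val2 u = (val2 (halve u)).+1.
      by rewrite -val2_double ?hE; [congr val2|]; lia.
    have v1 : val2 (halve u) = (val2 (halve u)).-1.+1.
      have -> : halve u = 2 * (halve u %/ 2)%Z by rewrite hE; lia.
      by rewrite val2_double // hE; lia.
    have h2 : (2 %| halve u)%Z by rewrite hE; lia.
    rewrite /line_bcd u2 h2 /Defs.shift -v1 vE /=; case: ifP => // _.
    by rewrite /halve u2; case: ifP; lia.
  have hE : halve u = ((u - 3) %/ 2)%Z by rewrite /halve (negPf u2).
  have vE : val2 (u + 3) = (val2 (halve u + 3)).+1.
    by rewrite -val2_double ?hE; [congr val2|]; lia.
  have v1 : val2 (halve u + 3) = (val2 (halve u + 3)).-1.+1.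
    have -> : halve u + 3 = 2 * ((halve u + 3) %/ 2)%Z by rewrite hE; lia.
    by rewrite val2_double // hE; lia.
  have h2 : (2 %| halve u)%Z = false by rewrite hE; lia.
  rewrite /line_bcd (negPf u2) h2 /Defs.shift -v1 vE /=; case: ifP => // _.
  by rewrite /halve (negPf u2); case: ifP; lia.
have vE : (if (2 %| u)%Z then val2 u else val2 (u + 3)) = 1%N.
  case: ifP => u2.
    rewrite (_ : u = 2 * (u %/ 2)%Z); last lia.
    by rewrite val2_double ?val2_odd //; lia.
  rewrite (_ : u + 3 = 2 * ((u + 3) %/ 2)%Z); last lia.
  by rewrite val2_double ?val2_odd //; lia.
have -> : gray m.+1 (line_bcd i omega u) =
    false :: gray m (if omega 0%N != i then line_a (halve u) else halve u).
  rewrite /=; congr (_ :: gray m _).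
    by rewrite /line_bcd; do !case: ifP; lia.
  move: vE; rewrite /line_bcd; case: ifP => u2 -> /=; case: ifP => _.
  - by rewrite /line_a /halve u2; do !case: ifP; lia.
  - by rewrite /halve u2.
  - by rewrite /line_a /halve u2; do !case: ifP; lia.
  - by rewrite /halve u2.
case: m {IH} => //= m; rewrite /eps eq_sym.
case: eqP => _ //=.
exact: (congr1 (cons false) (gray_a m.+1 (halve u))).
Qed.

(** The Gray code only forgets the simultaneous change of all digits of [t],
    which is [u |-> - u - 3]. *)
Lemma gray_congr m u u' : gray m u = gray m u' ->
  (exists q, u - u' = 2 ^+ m.+1 * q) \/ (exists q, u + u' + 3 = 2 ^+ m.+1 * q).
Proof.
elim: m u u' => [u u' _|m IH u u' /= [uE /IH]].
  have [uu|uu] := boolP (2 %| u - u')%Z.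
    by left; exists ((u - u') %/ 2)%Z; lia.
  by right; exists ((u + u' + 3) %/ 2)%Z; lia.
rewrite /halve => -[] [q qE]; [left|right]; exists q; move: qE;
  rewrite (exprS 2 m.+1) -mulrA; set x := 2 ^+ m.+1 * q => qE;
  have x2 : (2 %| x)%Z by [rewrite /x exprS -mulrA dvdz_mulr];
  by move: uE qE; do 2 case: ifP; lia.
Qed.

(** The change of all digits is excluded by the residues modulo 3. *)
Lemma gray_inj u u' : ~~ (3 %| u)%Z -> (3 %| u - u')%Z ->
  (forall m, gray m u = gray m u') -> u = u'.
Proof.
move=> u3 uu gE; pose m := (absz (u - u')%R + absz (u + u' + 3)%R)%N.
have : (m%:Z < 2 ^+ m.+1).
  apply: (@lt_le_trans _ _ (2 ^+ m)).
    by have := ltn_expl m (isT : (1 < 2)%N); rewrite -ltz_nat -[Posz (2 ^ m)]natz natrX natz.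
  by rewrite exprS; have := exprn_gt0 m (isT : 0 < 2 :> int); lia.
have [[q qE]|[q qE]] := gray_congr (gE m); move: qE; set e := 2 ^+ m.+1;
  rewrite /m; have [->|q0] := eqVneq q 0; nia.
Qed.

Lemma gray_surj (s : vertex) (c : int) : 1 <= c < 3 ->
  exists u, (u %% 3)%Z = c /\ gray (size s) u = s.
Proof.
elim: s c => [|x s IH] c c3; first by exists c; split=> //; lia.
have [u [uc us]] := IH (3 - c) ltac:(lia).
pose v := if x == (2 %| u)%Z then 2 * u else 2 * u + 3.
have hv : halve v = u by rewrite /halve /v; do !case: ifP; lia.
exists v; split; first by rewrite /v; case: ifP; lia.
rewrite /= hv us; congr (_ :: _).
by rewrite /v; clear -u; case: x; case: ifP; lia.
Qed.

(** The parity makes consecutive labels distinct whatever [omega] is, which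
    ensures aperiodicity; the two tests single out the second copy of the line
    and the edges of [a]. *)
Definition grig_label (omega : Omega) (k : nat) : 'I_3 * bool * bool * bool :=
  (omega k.-2, odd k, k == 0%N, k == 1%N).

Lemma grig_label_neq omega k : grig_label omega k <> grig_label omega k.+1.
Proof. by case=> _ /=; case: odd. Qed.

Section Embedding.
Context (omega : Omega).

Let w := toeplitz (grig_label omega).
Let S := three_cycles w.

(** Vertices [v] of the line are doubled into [2 v] and [2 v + 1] so that a
    generator of the Grigorchuk group, which exchanges [v] and [v + 1] for some
    [v], becomes a product of double transpositions. *)
Definition swap_pairs : zperm := (cyc 0 2 1 * cyc 2 1 3)%g.

Definition edges (P : pred nat) : set int :=
  [set n | (0 < val2 (3 * n + 8))%N && P (val2 (3 * n + 8)).-1].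

Definition edges_a := edges (pred1 0%N).

Definition edges_bcd (i : 'I_3) :=
  edges (fun k => (0 < k)%N && (omega k.-1 != i)).

(** The vertex of the line on which [n] lies; 3 does not divide it. *)
Definition coord (n : int) : int := 3 * (n %/ 2)%Z + 1.

Lemma supp_swap_pairs : supp_lt 4 swap_pairs.
Proof. by apply: supp_ltM; apply: supp_lt_cyc. Qed.

Lemma val2_eq0 (y : int) : y != 0 -> (val2 y == 0%N) = ~~ (2 %| y)%Z.
Proof.
move=> y0; apply/eqP/idP => [v0|]; last exact: val2_odd.
by have [z] := val2P y0; rewrite v0 expr0 mul1r => ->; lia.
Qed.

Lemma edges_a_mod n : edges_a n -> (n %% 4)%Z = 2.
Proof.
move=> /andP[v0 /eqP v1]; have : 3 * n + 8 != 0 by lia.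
move=> /val2P[z]; case: (val2 _) v0 v1 => [|[|k]] // _ _.
by rewrite expr1; lia.
Qed.

Lemma edges_bcd_mod i n : edges_bcd i n -> (n %% 4)%Z = 0.
Proof.
move=> /andP[v0 /andP[v1 _]]; have : 3 * n + 8 != 0 by lia.
move=> /val2P[z]; case: (val2 _) v0 v1 => [|[|k]] // _ _.
by rewrite 2!exprS -!mulrA; lia.
Qed.

Lemma sep_mod (D : set int) c : (forall n, D n -> (n %% 4)%Z = c) -> sep 4 D.
Proof. by move=> Dc n n' /Dc nc /Dc nc' nn; lia. Qed.

Lemma locset_edges (P : pred nat) :
  (forall k k', grig_label omega k = grig_label omega k' ->
    (0 < k)%N && P k.-1 -> (0 < k')%N && P k'.-1) ->
  locset w (edges P).
Proof.
by move=> lP; exists 0%N => n n' /(_ 0 isT); rewrite /w /toeplitz !addr0 => /lP.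
Qed.

Lemma locset_edges_a : locset w edges_a.
Proof.
apply: locset_edges => k k' [_ _ _ e] /andP[k0 /eqP k1].
by have : k' == 1%N; [rewrite -e; lia|move=> /eqP->].
Qed.

Lemma locset_edges_bcd i : locset w (edges_bcd i).
Proof.
apply: locset_edges => k k' [oe _ e0 e1] /andP[k0 /andP[k1 ki]].
by move: ki; rewrite -!subn1 -!subnDA !subn2 oe => ->; rewrite andbT; lia.
Qed.

Lemma spread_swap_three_cycles D : locset w D -> sep 4 D ->
  gen_set S (spread 4 D swap_pairs).
Proof.
move=> lD sD; rewrite /swap_pairs (spreadM sD (@subset_refl _ D)); first last.
- exact: supp_lt_cyc.
- exact: supp_lt_cyc.
have [_ SM _] := gen_set_subgroup S.
apply: SM => L [_]; apply.
  by exists 4, D, 0, 2, 1.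
by exists 4, D, 2, 1, 3.
Qed.

Lemma spread_swapE (D : set int) n : sep 4 D -> (forall n, D n -> (2 %| n)%Z) ->
  spread 4 D swap_pairs n =
    if `[< D (2 * (n %/ 2)%Z) >] then n + 2
    else if `[< D (2 * (n %/ 2)%Z - 2) >] then n - 2 else n.
Proof.
move=> sD D2; have [sI sO] := spreadP sD supp_swap_pairs.
have sw : [/\ swap_pairs 0 = 2, swap_pairs 1 = 3, swap_pairs 2 = 0
            & swap_pairs 3 = 1] by [].
case: sw => s0 s1 s2 s3.
have nE : n = 2 * (n %/ 2)%Z + (n %% 2)%Z by have := divz_eq n 2; lia.
case: asboolP => [Dn|Dn].
  have : (n %% 2)%Z = 0 \/ (n %% 2)%Z = 1 by lia.
  by case=> n2; rewrite [in LHS]nE [(n %% 2)%Z]n2 sI // ?s0 ?s1; lia.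
case: asboolP => [Dn'|Dn'].
  have : (n %% 2)%Z = 0 \/ (n %% 2)%Z = 1 by lia.
  case=> n2.
    rewrite [in LHS](_ : n = 2 * (n %/ 2)%Z - 2 + 2); last lia.
    by rewrite sI // s2; lia.
  rewrite [in LHS](_ : n = 2 * (n %/ 2)%Z - 2 + 3); last lia.
  by rewrite sI // s3; lia.
apply: sO => n' Dn1; apply/negP => nn; have := D2 _ Dn1.
have [e|e] : n' = 2 * (n %/ 2)%Z \/ n' = 2 * (n %/ 2)%Z - 2 by have := D2 _ Dn1; lia.
  by rewrite e in Dn1.
by rewrite e in Dn1.
Qed.

(** [tracks g h] says that [h] acts on the line as [g] does on the tree, each
    [n] standing for the ray whose finite prefixes are the [gray m (coord n)]. *)
Definition tracks (g : tree_aut) (h : zperm) := [/\ gen_set S h,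
  forall n, (h n %% 2)%Z = (n %% 2)%Z
  & forall m n, gray m (coord (h n)) = g (gray m (coord n))].

Lemma tracks1 : tracks 1%g 1%g.
Proof. by split=> //; case: (gen_set_subgroup S). Qed.

Lemma tracksM g g' h h' : tracks g h -> tracks g' h' ->
  tracks (g * g')%g (h * h')%g.
Proof.
have [_ SM _] := gen_set_subgroup S.
move=> [Sh h2 hg] [Sh' h2' hg']; split=> [|n|m n]; first exact: SM.
  by rewrite zpM h2 h2'.
by rewrite zpM hg hg'.
Qed.

Lemma tracksV (g : tree_aut) h : tracks g h -> tracks (g^-1)%g (h^-1)%g.
Proof.
have [_ _ SV] := gen_set_subgroup S.
move=> [Sh h2 hg]; split=> [|n|m n]; first exact: SV.
  by rewrite -[in RHS](zpKV h n) h2.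
by rewrite -[in RHS](zpKV h n) hg /= aut_funK.
Qed.

(** The rays separate the vertices of the line. *)
Lemma tracks_fun (g : tree_aut) h h' : tracks g h -> tracks g h' -> h = h'.
Proof.
move=> [_ h2 hg] [_ h2' hg']; apply: zpermP => n.
have : coord (h n) = coord (h' n).
  by apply: gray_inj; rewrite /coord; [lia|lia|move=> m; rewrite hg hg'].
by have := h2 n; have := h2' n; rewrite /coord; lia.
Qed.

(** The prefixes of the rays exhaust the tree. *)
Lemma tracks_inj (g g' : tree_aut) h : tracks g h -> tracks g' h -> g = g'.
Proof.
move=> [_ _ hg] [_ _ hg']; apply: tree_autP => v.
have [u [u1 uv]] := @gray_surj v 1 ltac:(lia).
have uE : u = coord (2 * (u %/ 3)%Z) by rewrite /coord; lia.
by rewrite -uv uE -hg -hg'.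
Qed.

Lemma tracks_spread (P : pred nat) (g : tree_aut) (line : int -> int) :
  locset w (edges P) -> sep 4 (edges P) ->
  (forall c : int, (c %% 3)%Z = 1 -> line c =
    if P (val2 (c + 3)) then c + 3 else if P (val2 c) then c - 3 else c) ->
  (forall m c, ~~ (3 %| c)%Z -> gray m (line c) = g (gray m c)) ->
  tracks g (spread 4 (edges P) swap_pairs).
Proof.
move=> lD sD lineE gE.
have D2 n : edges P n -> (2 %| n)%Z.
  by move=> /andP[+ _]; rewrite lt0n val2_eq0; lia.
have DE n (c : int) : 3 * n + 8 = 2 * c -> edges P n <-> P (val2 c).
  move=> nc; have c0 : c != 0 by lia.
  by rewrite /edges /= nc val2_double.
have ev n : coord (spread 4 (edges P) swap_pairs n) = line (coord n) /\
    (spread 4 (edges P) swap_pairs n %% 2)%Z = (n %% 2)%Z.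
  rewrite (spread_swapE n sD D2) (lineE (coord n)); last by rewrite /coord; lia.
  have e1 := DE (2 * (n %/ 2)%Z) (coord n + 3) ltac:(rewrite /coord; lia).
  have e2 := DE (2 * (n %/ 2)%Z - 2) (coord n) ltac:(rewrite /coord; lia).
  rewrite (asbool_equiv_eq e1) (asbool_equiv_eq e2) !asboolb.
  case: (P (val2 (coord n + 3))); first by rewrite /coord; split; lia.
  by case: (P (val2 (coord n))); rewrite /coord; split; lia.
split=> [|n|m n].
- exact: spread_swap_three_cycles.
- by case: (ev n).
- by case: (ev n) => -> _; rewrite gE // /coord; lia.
Qed.

Lemma tracks_a : tracks gen_a (spread 4 edges_a swap_pairs).
Proof.
apply: (tracks_spread (line := line_a)); first exact: locset_edges_a.
- exact: sep_mod edges_a_mod.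
- move=> c c1 /=; rewrite !val2_eq0; [|lia|lia].
  by rewrite /line_a; do !case: ifP; lia.
- by move=> m c _; rewrite gray_a.
Qed.

Lemma tracks_bcd i : tracks (gen_bcd i omega) (spread 4 (edges_bcd i) swap_pairs).
Proof.
apply: (tracks_spread (line := line_bcd i omega)); first exact: locset_edges_bcd.
- exact: sep_mod (@edges_bcd_mod i).
- move=> c c1; rewrite !lt0n !val2_eq0 ?negbK; [|lia|lia].
  rewrite /line_bcd; have [c2|c2] := boolP (2 %| c)%Z.
    by rewrite (_ : (2 %| c + 3)%Z = false) //; lia.
  rewrite (_ : (2 %| c + 3)%Z) /=; last by lia.
  by case: ifP.
- by move=> m c c3; rewrite gray_bcd.
Qed.

Lemma grigorchuk_tracked (g : grigorchuk omega) :
  exists h : generated S, tracks (val g) (val h).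
Proof.
suff [h] : exists h, tracks (val g) h.
  move=> /[dup] gh [Sh _ _].
  by exists (Sub h (mem_set Sh) : generated S).
have : gen_set [set gen_a; gen_b omega; gen_c omega; gen_d omega] (val g).
  by have := valP g; rewrite inE.
move=> /(_ [set g | exists h, tracks g h]); apply; split.
  split; first by exists 1%g; exact: tracks1.
    by move=> x y [h xh] [k yk]; exists (h * k)%g; exact: tracksM.
  by move=> x [h xh]; exists (h^-1)%g; exact: tracksV.
move=> x [[[]|]|] ->; last 3 first; eexists.
- exact: tracks_bcd.
- exact: tracks_bcd.
- exact: tracks_bcd.
- exact: tracks_a.
Qed.

Theorem grigorchuk_embeds : embeds_in (grigorchuk omega) (generated S).
Proof.
have [phi phiP] : exists phi : grigorchuk omega -> generated S,
    forall g, tracks (val g) (val (phi g)).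
  by have [phi phiP] := boolp.choice grigorchuk_tracked; exists phi.
apply: (@embeds_in_morph _ _ phi).
  move=> x y; apply: val_inj; apply: tracks_fun (phiP _) _.
  exact: tracksM.
move=> x y xy; apply: val_inj; apply: tracks_inj (phiP x) _.
by rewrite xy; exact: phiP.
Qed.

End Embedding.

(** * Entropy of random walks *)

(** The arithmetic-geometric inequality with a free weight [d]; summed over a
    probability space it replaces the Cauchy--Schwarz inequality. *)
Lemma abs_sub_squares (R : realFieldType) (u v d : R) : 0 < d ->
  `|u ^+ 2 - v ^+ 2| <= (u - v) ^+ 2 / (2 * d) + d / 2 * (u + v) ^+ 2.
Proof.
move=> d0; have amgm (p q : R) : p * q <= p ^+ 2 / (2 * d) + d / 2 * q ^+ 2.
  rewrite -subr_ge0 (_ : _ - _ = (p - d * q) ^+ 2 / (2 * d)).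
    by rewrite divr_ge0 ?sqr_ge0 // mulr_ge0 // ltW.
  by field; rewrite gt_eqF.
rewrite ler_norml; apply/andP; split.
  rewrite lerNl (_ : - (u ^+ 2 - v ^+ 2) = (v - u) * (u + v)); last by ring.
  by rewrite (_ : (u - v) ^+ 2 = (v - u) ^+ 2) //; ring.
by rewrite (_ : u ^+ 2 - v ^+ 2 = (u - v) * (u + v)) //; ring.
Qed.

Lemma ler_sum_subset (R : numDomainType) (T : eqType) (r r' : seq T) (F : T -> R) :
  uniq r -> uniq r' -> {subset r <= r'} -> (forall x, 0 <= F x) ->
  \sum_(x <- r) F x <= \sum_(x <- r') F x.
Proof.
move=> ur ur' rr F0; rewrite [leRHS](bigID (mem r)) /=.
have -> : \sum_(x <- r' | x \in r) F x = \sum_(x <- r) F x.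
  rewrite -big_filter; apply: perm_big; apply: uniq_perm => //.
    exact: filter_uniq.
  by move=> x; rewrite mem_filter; case: (boolP (x \in r)) => // /rr ->.
by rewrite lerDl sumr_ge0.
Qed.

Section Walk.
Context (R : realType) (G : groupType) (s : seq G) (mu : G -> R).
Context (us : uniq s) (mu_gt0 : forall g, g \in s -> 0 < mu g).
Context (mu1 : \sum_(g <- s) mu g = 1).

(** Expectation of [F] at the [n]-th step of the walk [X_(n+1) = g X_n]. *)
Fixpoint wexp (n : nat) (F : G -> R) : R :=
  if n is n'.+1 then \sum_(g <- s) mu g * wexp n' (fun x => F (g * x)%g)
  else F 1%g.

Fixpoint reach (n : nat) : seq G :=
  if n is n'.+1 then [seq (g * x)%g | g <- s, x <- reach n'] else [:: 1%g].

Lemma reachS n g x : g \in s -> x \in reach n -> (g * x)%g \in reach n.+1.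
Proof. by move=> gs xn; apply: allpairs_f. Qed.

Lemma le_wexp n F F' : (forall x, x \in reach n -> F x <= F' x) ->
  wexp n F <= wexp n F'.
Proof.
elim: n F F' => [|n IH] F F' FF /=; first by apply: FF; rewrite inE.
rewrite big_seq [leRHS]big_seq; apply: ler_sum => g gs.
rewrite ler_pM2l ?mu_gt0 //; apply: IH => x xn; apply: FF.
exact: reachS.
Qed.

Lemma eq_wexp n F F' : (forall x, x \in reach n -> F x = F' x) ->
  wexp n F = wexp n F'.
Proof.
by move=> FF; apply/le_anti; rewrite !le_wexp // => x xn; rewrite FF.
Qed.

Lemma wexpD n F F' : wexp n (fun x => F x + F' x) = wexp n F + wexp n F'.
Proof.
elim: n F F' => [//|n IH] F F' /=; rewrite -big_split /=.
by apply: eq_bigr => g _; rewrite IH mulrDr.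
Qed.

Lemma wexpZ n c F : wexp n (fun x => c * F x) = c * wexp n F.
Proof.
elim: n F => [//|n IH] F /=; rewrite big_distrr /=.
by apply: eq_bigr => g _; rewrite IH mulrCA.
Qed.

Lemma wexpN n F : wexp n (fun x => - F x) = - wexp n F.
Proof.
rewrite -mulN1r -wexpZ; congr wexp.
by apply/funext => x; rewrite mulN1r.
Qed.

Lemma wexp_cst n c : wexp n (fun=> c) = c.
Proof.
by elim: n => [//|n IH] /=; rewrite IH -big_distrl /= mu1 mul1r.
Qed.

Lemma wexp_sum n (I : Type) (r : seq I) (F : I -> G -> R) :
  wexp n (fun x => \sum_(i <- r) F i x) = \sum_(i <- r) wexp n (F i).
Proof.
elim: r => [|i r IH].
  by rewrite big_nil -[RHS](wexp_cst n 0); apply: eq_wexp => x _; rewrite big_nil.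
rewrite big_cons -IH -wexpD; apply: eq_wexp => x _.
by rewrite big_cons.
Qed.

Definition law n x : R := wexp n (fun y => (y == x)%:R).

Lemma law_ge0 n x : 0 <= law n x.
Proof.
by rewrite -(wexp_cst n 0); apply: le_wexp => y _; rewrite ler0n.
Qed.

Lemma lawS n x : law n.+1 x = \sum_(g <- s) mu g * law n (g^-1 * x)%g.
Proof.
rewrite /law /=; apply: eq_bigr => g _; congr (_ * _); apply: eq_wexp => y _.
congr (_%:R); congr nat_of_bool.
by apply/eqP/eqP => [<-|->]; rewrite ?mulKg ?mulVKg.
Qed.

Lemma lawS_ge n g x : g \in s -> mu g * law n x <= law n.+1 (g * x)%g.
Proof.
move=> gs; rewrite lawS (bigD1_seq g) //= mulKg lerDl.
rewrite big_seq_cond; apply: sumr_ge0 => h /andP[hs _].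
by rewrite mulr_ge0 ?law_ge0 // ltW // mu_gt0.
Qed.

Lemma law_gt0 n x : x \in reach n -> 0 < law n x.
Proof.
elim: n x => [x|n IH _ /allpairsP[[g x] /= [gs xn ->]]].
  by rewrite inE => /eqP ->; rewrite /law /= eqxx ltr01.
apply: lt_le_trans (lawS_ge n x gs).
by rewrite mulr_gt0 ?mu_gt0 // IH.
Qed.

Lemma wexp_law n F (U : seq G) : uniq U -> {subset reach n <= U} ->
  wexp n F = \sum_(x <- U) law n x * F x.
Proof.
move=> uU nU.
rewrite (eq_wexp (F' := fun y => \sum_(x <- U) F x * (y == x)%:R)).
  by rewrite wexp_sum; apply: eq_bigr => x _; rewrite wexpZ mulrC.
move=> y /nU yU; rewrite (bigD1_seq y) //= eqxx mulr1 big1 ?addr0 // => x.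
by rewrite eq_sym => /negPf ->; rewrite mulr0.
Qed.

Lemma sum_law n (U : seq G) : uniq U -> {subset reach n <= U} ->
  \sum_(x <- U) law n x = 1.
Proof.
move=> uU nU; rewrite -(wexp_cst n 1) (wexp_law _ uU nU).
by apply: eq_bigr => x _; rewrite mulr1.
Qed.

Lemma size_reach n : size (reach n) = (size s ^ n)%N.
Proof. by elim: n => //= n IH; rewrite size_allpairs IH expnS. Qed.

Definition ent n := wexp n (fun x => - ln (law n x)).

(** The relative entropy of the law of [g X_n] with respect to that of
    [X_(n+1)]. *)
Definition ent_gap n g :=
  wexp n (fun x => ln (law n x) - ln (law n.+1 (g * x)%g)).

(** The Hellinger affinity of the same two laws. *)
Definition affinity n g :=
  wexp n (fun x => Num.sqrt (law n.+1 (g * x)%g / law n x)).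

(** The law of [X_(n+1)] is the average of the laws of [g X_n], so the increment
    of the entropy is an average of relative entropies. *)
Lemma ent_step n : ent n.+1 - ent n = \sum_(g <- s) mu g * ent_gap n g.
Proof.
rewrite -[ent n]mul1r -mu1 big_distrl /= /ent /= -sumrB.
apply: eq_bigr => g _; rewrite -mulrBr -wexpN -wexpD; congr (_ * _).
by apply: eq_wexp => x _; rewrite opprK addrC.
Qed.

(** [- ln t = - 2 * ln (sqrt t) >= 2 * (1 - sqrt t)]. *)
Lemma ent_gap_affinity n g : g \in s -> 2 * (1 - affinity n g) <= ent_gap n g.
Proof.
move=> gs; rewrite -[X in 2 * (X - _)](wexp_cst n 1) -wexpN -wexpD -wexpZ.
apply: le_wexp => x xn.
have a0 : 0 < law n x by apply: law_gt0.
have b0 : 0 < law n.+1 (g * x)%g by apply: law_gt0; apply: reachS.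
set t := Num.sqrt _; have t0 : 0 < t by rewrite sqrtr_gt0 divr_gt0.
have -> : ln (law n x) - ln (law n.+1 (g * x)%g) = - (ln t *+ 2).
  rewrite -lnXn // sqr_sqrtr ?divr_ge0 ?law_ge0 //.
  by rewrite ln_div ?posrE // opprB.
have := @le_ln1Dx R (t - 1); rewrite (_ : 1 + (t - 1) = t); last by ring.
move=> H.
rewrite mulr2n; have := H ltac:(lra); move: (ln t) => l. lra.
Qed.

Lemma affinity_le1 n g : g \in s -> affinity n g <= 1.
Proof.
move=> gs; pose U := undup (reach n).
have sq (t : R) : 0 <= t -> Num.sqrt t <= (1 + t) / 2.
  move=> t0; have := sqr_ge0 (Num.sqrt t - 1).
  by rewrite sqrrB1 sqr_sqrtr //; lra.
apply: (@le_trans _ _ (wexp n (fun x =>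
    1 / 2 + 1 / 2 * (law n.+1 (g * x)%g / law n x)))).
  apply: le_wexp => x xn; have := sq _ (divr_ge0 (law_ge0 n.+1 (g * x)%g) (law_ge0 n x)).
  by lra.
rewrite wexpD wexp_cst wexpZ.
suff : wexp n (fun x => law n.+1 (g * x)%g / law n x) <= 1 by lra.
have uU : uniq U by apply: undup_uniq.
rewrite (wexp_law _ uU); last by move=> x; rewrite mem_undup.
have uV : uniq (undup (reach n.+1)) by apply: undup_uniq.
have V1 : \sum_(x <- undup (reach n.+1)) law n.+1 x = 1.
  by apply: sum_law => // x; rewrite mem_undup.
rewrite -V1; apply: (@le_trans _ _ (\sum_(x <- [seq (g * x)%g | x <- U]) law n.+1 x)).
  rewrite big_map le_eqVlt; apply/orP; left; apply/eqP.
  apply: eq_big_seq => x; rewrite mem_undup => xn.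
  by rewrite mulrCA mulfV ?mulr1 // gt_eqF // law_gt0.
apply: ler_sum_subset => //; last exact: law_ge0.
  by rewrite map_inj_uniq //; apply: mulgI.
move=> _ /mapP[x xU ->]; rewrite mem_undup; apply: reachS => //.
by rewrite -mem_undup.
Qed.

(** Total variation between the laws of [g X_n] and [X_(n+1)], tested on [F]. *)
Lemma wexp_translate n g F (d : R) : g \in s -> 0 < d ->
  (forall x, `|F x| <= 1) ->
  `|wexp n (fun x => F (g * x)%g) - wexp n.+1 F|
    <= (1 - affinity n g) / d + 2 * d.
Proof.
move=> gs d0 F1; pose V := undup (reach n.+1).
have uV : uniq V by apply: undup_uniq.
have VP : {subset reach n.+1 <= V} by move=> x; rewrite mem_undup.
pose W := [seq (g^-1 * x)%g | x <- V].
have uW : uniq W by rewrite map_inj_uniq //; apply: mulgI.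
have WP : {subset reach n <= W}.
  move=> x xn; apply/mapP; exists (g * x)%g; last by rewrite mulKg.
  by apply: VP; apply: reachS.
pose a x := law n (g^-1 * x)%g; pose b x := law n.+1 x.
have E1 (F' : G -> R) : wexp n (fun x => F' (g * x)%g) = \sum_(x <- V) a x * F' x.
  rewrite (wexp_law _ uW WP) big_map; apply: eq_bigr => x _.
  by rewrite mulVKg.
have a1 : \sum_(x <- V) a x = 1.
  rewrite -(wexp_cst n 1) (E1 (fun=> 1)).
  by apply: eq_bigr => x _; rewrite mulr1.
have b1 : \sum_(x <- V) b x = 1 by apply: sum_law.
have aff : affinity n g = \sum_(x <- V) Num.sqrt (a x) * Num.sqrt (b x).
  pose f x := Num.sqrt (law n.+1 x / law n (g^-1 * x)%g).
  transitivity (wexp n (fun x => f (g * x)%g)).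
    by apply: eq_wexp => x _; rewrite /f mulKg.
  rewrite E1; apply: eq_bigr => x _; rewrite /f -/(a x) -/(b x).
  have := law_ge0 n (g^-1 * x)%g; rewrite -/(a x) le_eqVlt => /predU1P[<-|a0].
    by rewrite mul0r sqrtr0 mul0r.
  rewrite sqrtrM ?law_ge0 // sqrtrV ?ltW // mulrCA [RHS]mulrC; congr (_ * _).
  by rewrite -{1}(sqr_sqrtr (ltW a0)) expr2 mulfK // gt_eqF // sqrtr_gt0.
rewrite E1 (wexp_law _ uV VP) -sumrB.
apply: le_trans (ler_norm_sum _ _ _) _.
have term x : `|a x * F x - law n.+1 x * F x| <=
    (a x + b x - 2 * (Num.sqrt (a x) * Num.sqrt (b x))) / (2 * d)
    + d * (a x + b x).
  rewrite -/(b x) -mulrBl normrM.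
  apply: (@le_trans _ _ (`|a x - b x|)); first by rewrite ler_piMr.
  have := abs_sub_squares (Num.sqrt (a x)) (Num.sqrt (b x)) d0.
  rewrite !sqr_sqrtr ?law_ge0 // => /le_trans; apply.
  have sa := sqr_sqrtr (law_ge0 n (g^-1 * x)%g : 0 <= a x).
  have sb := sqr_sqrtr (law_ge0 n.+1 x : 0 <= b x).
  move: (Num.sqrt (a x)) (Num.sqrt (b x)) sa sb => u v <- <-.
  have -> : (u - v) ^+ 2 = u ^+ 2 + v ^+ 2 - 2 * (u * v) by ring.
  rewrite lerD2l -subr_ge0.
  rewrite (_ : _ - _ = d / 2 * (u - v) ^+ 2); last by field.
  by rewrite mulr_ge0 ?sqr_ge0 // divr_ge0 // ltW.
apply: le_trans (ler_sum _ (fun x _ => term x)) _.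
rewrite big_split /= -mulr_sumr -mulr_suml sumrB -mulr_sumr big_split /=.
rewrite a1 b1 -aff le_eqVlt; apply/orP; left; apply/eqP; field.
by rewrite gt_eqF.
Qed.

(** Gibbs' inequality against the half-half mixture of the uniform laws on the
    good part of the support and on the whole support. *)
Lemma ent_le n (gd : pred G) (N : nat) : (0 < N)%N -> (0 < size s)%N ->
  (size [seq x <- undup (reach n) | gd x] <= N)%N ->
  ent n <= ln (2 * N%:R) +
    wexp n (fun x => (~~ gd x)%:R) * ln (2 * (size s)%:R ^+ n).
Proof.
move=> N0 s0 gN; pose U := undup (reach n).
have uU : uniq U by apply: undup_uniq.
have UP : {subset reach n <= U} by move=> x; rewrite mem_undup.
pose Q : R := (size s)%:R ^+ n.
have Q1 : 1 <= Q by rewrite /Q -natrX ler1n expn_gt0 s0.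
have UQ : (size U)%:R <= Q.
  by rewrite /Q -natrX ler_nat -size_reach size_undup.
have N1 : 1 <= N%:R :> R by rewrite ler1n.
pose r x : R := 1 / 2 * ((gd x)%:R / N%:R + 1 / Q).
have rQ x : 1 / (2 * Q) <= r x.
  by rewrite /r !mul1r invfM ler_pM2l ?invr_gt0 // lerDr divr_ge0 ?ler0n.
have r0 x : 0 < r x.
  by apply: lt_le_trans (rQ x); rewrite divr_gt0 // mulr_gt0 //; lra.
have rN x : gd x -> 1 / (2 * N%:R) <= r x.
  move=> gx; rewrite /r gx !mul1r invfM ler_pM2l ?invr_gt0 // lerDl invr_ge0; lra.
have E1 : wexp n (fun x => r x / law n x) <= 1.
  rewrite (wexp_law _ uU UP).
  have -> : \sum_(x <- U) law n x * (r x / law n x) = \sum_(x <- U) r x.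
    apply: eq_big_seq => x; rewrite mem_undup => xn.
    by rewrite mulrCA mulfV ?mulr1 // gt_eqF // law_gt0.
  rewrite /r -mulr_sumr big_split /= -mulr_suml.
  have -> : \sum_(x <- U) (gd x)%:R = (size [seq x <- U | gd x])%:R :> R.
    by rewrite size_filter -sum1_count natr_sum [RHS]big_mkcond; apply: eq_bigr => x _; case: (gd x).
  have -> : \sum_(x <- U) 1 / Q = (size U)%:R / Q.
    by rewrite big_const_seq count_predT iter_addr_0 mul1r mulr_natl.
  have : (size [seq x <- U | gd x])%:R / N%:R <= 1 :> R.
    by rewrite ler_pdivrMr ?mul1r ?ler_nat //; lra.
  have : (size U)%:R / Q <= 1 by rewrite ler_pdivrMr ?mul1r //; lra.
  by lra.
have lN : 0 <= ln (2 * N%:R : R) by apply: ln_ge0; lra.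
have lnr x : - ln (r x) <= ln (2 * N%:R) + (~~ gd x)%:R * ln (2 * Q).
  have lQ : - ln (r x) <= ln (2 * Q).
    rewrite lerNl -lnV ?posrE ?ler_ln ?posrE ?invr_gt0 //; try lra.
    by rewrite -[_^-1]mul1r.
  case: (boolP (gd x)) => gx /=; last by rewrite mul1r; lra.
  rewrite mul0r addr0 lerNl -lnV ?posrE ?ler_ln ?posrE ?invr_gt0 //; try lra.
  by rewrite -[_^-1]mul1r; apply: rN.
apply: (@le_trans _ _ (wexp n (fun x => (ln (2 * N%:R) +
    (~~ gd x)%:R * ln (2 * Q)) + (r x / law n x + (- 1))))).
  apply: le_wexp => x xn; have q0 := law_gt0 xn.
  have := @le_ln1Dx R (r x / law n x - 1).
  rewrite (_ : 1 + (r x / law n x - 1) = r x / law n x); last by ring.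
  rewrite ln_div ?posrE // => H; have := lnr x.
  have := divr_gt0 (r0 x) q0; move=> rq0; have := H ltac:(lra); lra.
rewrite 3!wexpD !wexp_cst -[X in _ + X + _](_ : wexp n (fun x => ln (2 * Q) * (~~ gd x)%:R) = _).
  by rewrite wexpZ mulrC; lra.
by apply: eq_wexp => x _; rewrite mulrC.
Qed.

(** Otherwise all the increments would exceed [e], and so would the mean slope. *)
Lemma ent_slow_step (e : R) : 0 < e -> (exists2 n, (0 < n)%N & ent n <= e * n%:R) ->
  exists n, ent n.+1 - ent n <= e.
Proof.
move=> e0 [n n0 en]; apply: contrapT => nex.
have big m : e * m%:R <= ent m /\ ((0 < m)%N -> e * m%:R < ent m).
  elim: m => [|m [IH _]].
    by split=> //; rewrite mulr0 /ent /= /law /= eqxx ln1 oppr0.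
  have : e < ent m.+1 - ent m by rewrite ltNge; apply/negP => le; apply: nex; exists m.
  by rewrite -natr1 mulrDr mulr1 => h; split=> [|_]; lra.
by have [_ /(_ n0)] := big n; lra.
Qed.

Lemma mu_lower : exists2 m : R, 0 < m & forall g, g \in s -> m <= mu g.
Proof.
elim: s mu_gt0 => [|g s' IH] pos; first by exists 1.
have [m m0 mP] := IH (fun h hs => pos h (mem_behead (s := g :: s') hs)).
exists (Num.min m (mu g)); first by rewrite lt_min m0 pos ?mem_head.
move=> h; rewrite inE => /predU1P[->|/mP mh]; rewrite ge_min ?lexx ?orbT //.
by rewrite mh.
Qed.

(** Sublinear entropy makes the relative entropies of the translated laws
    small at some time, hence also their total variation distances. *)
Theorem slow_entropy_mixing :
  (forall e, 0 < e -> exists2 n, (0 < n)%N & ent n <= e * n%:R) ->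
  forall d, 0 < d -> exists n, forall g F, g \in s -> (forall x, `|F x| <= 1) ->
    `|wexp n (fun x => F (g * x)%g) - wexp n.+1 F| <= d.
Proof.
move=> slow d d0; have [m m0 mP] := mu_lower.
have d3 : 0 < d / 3 by lra.
have e0 : 0 < 2 * m * (d / 3) ^+ 2 by rewrite mulr_gt0 ?exprn_gt0 //; lra.
have [n nP] := ent_slow_step e0 (slow _ e0).
exists n => g F gs F1.
apply: le_trans (wexp_translate n gs d3 F1) _.
have gap h : h \in s -> 0 <= ent_gap n h.
  by move=> hs; have := ent_gap_affinity n hs; have := affinity_le1 n hs; lra.
have g1 : mu g * (2 * (1 - affinity n g)) <= 2 * m * (d / 3) ^+ 2.
  apply: le_trans nP; rewrite ent_step (bigD1_seq g) //=.
  apply: (@le_trans _ _ (mu g * ent_gap n g)).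
    by rewrite ler_pM2l ?mu_gt0 // ent_gap_affinity.
  rewrite lerDl big_seq_cond; apply: sumr_ge0 => h /andP[hs _].
  by rewrite mulr_ge0 ?gap // ltW // mu_gt0.
have a0 : 0 <= 1 - affinity n g by have := affinity_le1 n gs; lra.
have g2 : 1 - affinity n g <= (d / 3) ^+ 2.
  rewrite -(ler_pM2l (_ : 0 < 2 * m)); last lra.
  apply: le_trans g1; rewrite mulrCA -mulrA ler_pM2l // ler_wpM2r //.
  exact: mP.
have : (1 - affinity n g) / (d / 3) <= d / 3.
  by rewrite ler_pdivrMr // -expr2.
lra.
Qed.

End Walk.

(** * Gaussian bounds for symmetric walks on the line *)

Section FiniteSupport.
Context (R : realType).
Implicit Types f g : int -> R.

Definition fin_supp f := exists r : seq int, forall v, v \notin r -> f v = 0.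

Definition isum f : R := \sum_(v \in [set: int]) f v.

Lemma isumE f (r : seq int) : uniq r -> (forall v, v \notin r -> f v = 0) ->
  isum f = \sum_(v <- r) f v.
Proof.
move=> ur fr; rewrite /isum (fsbigE r) //; last by move=> v _ /fr.
by apply: eq_bigl => v; rewrite in_setT.
Qed.

Lemma fin_suppD f g : fin_supp f -> fin_supp g -> fin_supp (fun v => f v + g v).
Proof.
move=> [r fr] [r' gr]; exists (r ++ r') => v.
by rewrite mem_cat negb_or => /andP[/fr-> /gr->]; rewrite addr0.
Qed.

Lemma fin_suppMl f g : fin_supp f -> fin_supp (fun v => f v * g v).
Proof. by move=> [r fr]; exists r => v /fr->; rewrite mul0r. Qed.

Lemma fin_suppZ c f : fin_supp f -> fin_supp (fun v => c * f v).
Proof. by move=> [r fr]; exists r => v /fr->; rewrite mulr0. Qed.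

Lemma fin_supp_perm (h : zperm) f : fin_supp f -> fin_supp (fun v => f (h v)).
Proof.
move=> [r fr]; exists [seq (h^-1)%g v | v <- r] => v vr; apply: fr.
by apply: contra vr => hv; apply/mapP; exists (h v); rewrite ?zpK.
Qed.

Lemma fin_supp_sum (I : Type) (s : seq I) (F : I -> int -> R) :
  (forall i, fin_supp (F i)) -> fin_supp (fun v => \sum_(i <- s) F i v).
Proof.
move=> fF; elim: s => [|i s IH]; first by exists [::] => v _; rewrite big_nil.
rewrite (_ : (fun v => _) = (fun v => F i v + \sum_(j <- s) F j v)).
  exact: fin_suppD.
by apply/funext => v; rewrite big_cons.
Qed.

Lemma isumD f g : fin_supp f -> fin_supp g ->
  isum (fun v => f v + g v) = isum f + isum g.
Proof.
move=> [r fr] [r' gr]; pose l := undup (r ++ r').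
have ul : uniq l by apply: undup_uniq.
have fl v : v \notin l -> f v = 0.
  by rewrite mem_undup mem_cat negb_or => /andP[/fr].
have gl v : v \notin l -> g v = 0.
  by rewrite mem_undup mem_cat negb_or => /andP[_ /gr].
rewrite (isumE ul fl) (isumE ul gl) -big_split /= (isumE ul) // => v vl.
by rewrite fl // gl // addr0.
Qed.

Lemma isumZ c f : isum (fun v => c * f v) = c * isum f.
Proof. by rewrite /isum -mulr_fsumr. Qed.

Lemma isum_sum (I : Type) (s : seq I) (F : I -> int -> R) :
  (forall i, fin_supp (F i)) ->
  isum (fun v => \sum_(i <- s) F i v) = \sum_(i <- s) isum (F i).
Proof.
move=> fF; elim: s => [|i s IH].
  rewrite big_nil (isumE (r := [::])) ?big_nil // => v _.
  by rewrite big_nil.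
rewrite big_cons -IH -isumD //; last exact: fin_supp_sum.
by congr isum; apply/funext => v; rewrite big_cons.
Qed.

Lemma isum_perm (h : zperm) f : isum (fun v => f (h v)) = isum f.
Proof.
rewrite /isum [RHS](reindex_fsbigT h) //.
by exists (h^-1)%g; [apply: zpK|apply: zpKV].
Qed.

Lemma isum_ge0 f : (forall v, 0 <= f v) -> 0 <= isum f.
Proof. by move=> f0; apply: fsumr_ge0. Qed.

Lemma isum_le f g : fin_supp f -> fin_supp g -> (forall v, f v <= g v) ->
  isum f <= isum g.
Proof.
move=> ff fg fg'; rewrite -subr_ge0 -mulN1r -isumZ -isumD //; last exact: fin_suppZ.
by apply: isum_ge0 => v; rewrite mulN1r subr_ge0.
Qed.

Lemma isum_ge_term f v : fin_supp f -> (forall v, 0 <= f v) -> f v <= isum f.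
Proof.
move=> [r fr] f0; have ul : uniq (undup (v :: r)) by apply: undup_uniq.
rewrite (isumE ul); last first.
  by move=> w; rewrite mem_undup inE negb_or => /andP[_ /fr].
have vl : v \in undup (v :: r) by rewrite mem_undup mem_head.
by move: (undup _) ul vl => l ul vl; rewrite (bigD1_seq v) //= lerDl sumr_ge0.
Qed.

Definition ip f g := isum (fun v => f v * g v).

Lemma ipC f g : ip f g = ip g f.
Proof. by congr isum; apply/funext => v; rewrite mulrC. Qed.

Lemma ip_comb c f f' g : fin_supp f -> fin_supp f' ->
  ip (fun v => f v + c * f' v) g = ip f g + c * ip f' g.
Proof.
move=> ff ff'; rewrite /ip -isumZ -isumD; first last.
- by apply: fin_suppZ; apply: fin_suppMl.
- exact: fin_suppMl.
by congr isum; apply/funext => v; rewrite mulrDl mulrA.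
Qed.

Lemma ip_combr c f f' g : fin_supp f -> fin_supp f' ->
  ip g (fun v => f v + c * f' v) = ip g f + c * ip g f'.
Proof. by move=> ff ff'; rewrite ipC ip_comb // ipC (ipC f'). Qed.

End FiniteSupport.

Section Carne.
Context (R : realType) (G : groupType) (s : seq G) (mu : G -> R).
Context (rho : G -> zperm).
Context (us : uniq s) (mu_ge0 : forall g, g \in s -> 0 <= mu g).
Context (mu1 : \sum_(g <- s) mu g = 1).
Context (sV : forall g, g \in s -> (g^-1)%g \in s).
Context (muV : forall g, mu (g^-1)%g = mu g).
Context (rhoV : forall g, rho (g^-1)%g = ((rho g)^-1)%g).
Implicit Types f : int -> R.

Definition markov f (v : int) : R := \sum_(g <- s) mu g * f (rho g v).

Lemma markov_fin f : fin_supp f -> fin_supp (markov f).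
Proof.
by move=> ff; apply: fin_supp_sum => g; apply: fin_suppZ; apply: fin_supp_perm.
Qed.

Lemma markov_comb c f f' :
  markov (fun v => f v + c * f' v) = (fun v => markov f v + c * markov f' v).
Proof.
apply/funext => v; rewrite /markov mulr_sumr -big_split /=.
by apply: eq_bigr => g _; rewrite mulrDr mulrCA.
Qed.

(** Symmetry of the measure, [g] being exchanged with its inverse. *)
Lemma markov_adjoint f f' : fin_supp f -> fin_supp f' ->
  ip (markov f) f' = ip f (markov f').
Proof.
move=> ff ff'.
have E h h' : fin_supp h -> fin_supp h' ->
    ip (markov h) h' = \sum_(g <- s) mu g * ip (fun v => h (rho g v)) h'.
  move=> fh fh'; rewrite /ip /markov.
  under [in LHS]eq_fun => v do rewrite mulr_suml.
  rewrite isum_sum.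
    apply: eq_bigr => g _; rewrite -isumZ; congr isum.
    by apply/funext => v; rewrite mulrA.
  by move=> g; apply/fin_suppMl/fin_suppZ/fin_supp_perm.
rewrite E // ipC E //.
have perm_s : perm_eq s [seq (g^-1)%g | g <- s].
  apply: uniq_perm => //; first by rewrite map_inj_uniq //; apply: invg_inj.
  move=> g; apply/idP/mapP => [gs|[h hs ->]]; last exact: sV.
  by exists (g^-1)%g; rewrite ?invgK // sV.
rewrite [RHS](perm_big _ perm_s) big_map; apply: eq_bigr => g _.
rewrite muV; congr (_ * _); rewrite /ip -[LHS](isum_perm (rho g)^-1%g).
by congr isum; apply/funext => v; rewrite zpKV mulrC rhoV.
Qed.

Lemma markov_contraction f : fin_supp f ->
  ip (markov f) (markov f) <= ip f f.
Proof.
move=> ff; pose q v := \sum_(g <- s) mu g * (f (rho g v) * f (rho g v)).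
have fq : fin_supp q.
  apply: fin_supp_sum => g; apply: fin_suppZ; apply: fin_suppMl.
  exact: fin_supp_perm.
apply: (@le_trans _ _ (isum q)).
  apply: isum_le => //; first by apply: fin_suppMl; apply: markov_fin.
  move=> v; set m := markov f v; rewrite -subr_ge0.
  have -> : q v - m * m = \sum_(g <- s) mu g * (f (rho g v) - m) ^+ 2.
    transitivity (\sum_(g <- s) (mu g * (f (rho g v) * f (rho g v)) +
        (- 2 * m) * (mu g * f (rho g v)) + m ^+ 2 * mu g)); last first.
      by apply: eq_bigr => g _; ring.
    by rewrite !big_split /= -!mulr_sumr mu1 -/(q v) -/(markov f v) -/m; ring.
  rewrite big_seq; apply: sumr_ge0 => g gs.
  by rewrite mulr_ge0 ?sqr_ge0 // mu_ge0.
rewrite /q isum_sum; last first.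
  by move=> g; apply: fin_suppZ; apply: fin_suppMl; apply: fin_supp_perm.
rewrite le_eqVlt; apply/orP; left; apply/eqP; rewrite -[RHS]mul1r -mu1 mulr_suml.
apply: eq_bigr => g _; rewrite isumZ; congr (_ * _).
exact: (isum_perm (rho g) (fun v => f v * f v)).
Qed.

(** The Chebyshev polynomials of the Markov operator [P]: the state holds
    [U_k(P) f] and [U_(k-1)(P) f], and [cheb] is [T_k(P) f]. *)
Fixpoint cheb_state f (k : nat) : (int -> R) * (int -> R) :=
  if k is k'.+1 then
    let: (a, b) := cheb_state f k' in (fun v => 2 * markov a v - b v, a)
  else (f, fun=> 0).

Definition cheb f k : int -> R :=
  let: (a, b) := cheb_state f k in fun v => a v - markov b v.

Let sub_comb (a b : int -> R) :
  (fun v => a v - b v) = (fun v => a v + (- 1) * b v).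
Proof. by apply/funext => v; rewrite mulN1r. Qed.

Let dbl_comb (a b : int -> R) :
  (fun v => 2 * a v - b v) = (fun v => (a v + (- 1) * b v) + 1 * a v).
Proof. by apply/funext => v; ring. Qed.

Let fin_comb c a b : fin_supp a -> fin_supp b ->
  fin_supp (fun v => a v + c * b v : R).
Proof. by move=> fa fb; apply: fin_suppD => //; apply: fin_suppZ. Qed.

(** The quadratic form [|a|^2 - 2 <a, P b> + |b|^2] is invariant along the
    Chebyshev recursion and bounds [|T_k(P) f|^2]; this replaces the spectral
    theorem. *)
Lemma cheb_norm f k : fin_supp f -> ip (cheb f k) (cheb f k) <= ip f f.
Proof.
move=> ff; rewrite /cheb.
suff : let: (a, b) := cheb_state f k in
    [/\ fin_supp a, fin_supp b
      & ip a a - 2 * ip a (markov b) + ip b b = ip f f].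
  case: (cheb_state f k) => a b [fa fb <-].
  have fPb := markov_fin fb.
  rewrite sub_comb ip_comb // !ip_combr // (ipC (markov b) a).
  by have := markov_contraction fb; lra.
elim: k => [|k] /=.
  have f0 : fin_supp (fun=> 0 : R) by exists [::].
  split=> //; rewrite (_ : markov (fun=> 0) = fun=> 0); last first.
    by apply/funext => v; rewrite /markov big1 // => g _; rewrite mulr0.
  have z g : ip g (fun=> 0) = 0.
    rewrite /ip (isumE (r := [::])) ?big_nil // => v _; exact: mulr0.
  by rewrite !z; ring.
case: (cheb_state f k) => a b [fa fb Q]; have fPa := markov_fin fa.
have f1 : fin_supp (fun v => markov a v + (- 1) * b v) by apply: fin_comb.
split=> //; first by rewrite dbl_comb; apply: fin_comb.
rewrite dbl_comb ip_comb // ip_comb // ip_comb // !ip_combr //.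
by rewrite ip_comb // -Q (ipC b (markov a)) (markov_adjoint fa fb); ring.
Qed.

Lemma cheb0 f : cheb f 0 = f.
Proof.
apply/funext => v; rewrite /cheb /= /markov big1 ?subr0 // => g _.
by rewrite mulr0.
Qed.

Lemma markov_cheb0 f : markov (cheb f 0) = cheb f 1.
Proof.
rewrite cheb0; apply/funext => v; rewrite /cheb /= subr0.
by rewrite mulr_natl mulr2n addrK.
Qed.

Lemma markov_cheb f k :
  markov (cheb f k.+1) = (fun v => 1 / 2 * (cheb f k.+2 v + cheb f k v)).
Proof.
rewrite /cheb /=; case: (cheb_state f k) => a b /=.
rewrite dbl_comb !sub_comb !markov_comb.
by apply/funext => v /=; rewrite dbl_comb !markov_comb; lra.
Qed.

Section Bound.
Context (B : nat) (rhoB : forall g v, g \in s -> `|rho g v - v| <= B%:Z).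

Lemma cheb_support u k v : (B * k)%N%:Z < `|v - u| ->
  cheb (fun v => (v == u)%:R) k v = 0.
Proof.
have P0 (h : int -> R) w : (forall g, g \in s -> h (rho g w) = 0) ->
    markov h w = 0.
  move=> h0; rewrite /markov big_seq big1 // => g gs.
  by rewrite h0 ?mulr0.
move: v; rewrite /cheb; set f := fun v => _.
suff : let: (a, b) := cheb_state f k in
    (forall v, (B * k)%N%:Z < `|v - u| -> a v = 0) /\
    (forall v, (B * k)%N%:Z < `|v - u| + B%:Z -> b v = 0).
  case: (cheb_state f k) => a b [a0 b0] v vk.
  rewrite a0 // P0 ?subr0 // => g gs; apply: b0.
  by have := rhoB v gs; lia.
elim: k => [|k] /=.
  by split=> // v; rewrite muln0 /f; case: eqP => // ->; rewrite subrr.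
case: (cheb_state f k) => a b [a0 b0]; split=> v vk; last first.
  by apply: a0; rewrite mulnS in vk; lia.
rewrite mulnS in vk; rewrite b0; last by lia.
rewrite P0 ?mulr0 ?subr0 // => g gs; apply: a0.
by have := rhoB v gs; lia.
Qed.

(** Varopoulos--Carne: expanding [P ^ n] in Chebyshev polynomials of [P], only
    those of degree at least the distance contribute. *)
Theorem carne (z : R) (d n : nat) u v : 1 <= z ->
  (forall j, (j < d)%N -> (B * j)%N%:Z < `|v - u|) ->
  `|iter n markov (fun v => (v == u)%:R) v|
    <= 2 * z ^- d * ((z + z^-1) / 2) ^+ n.
Proof.
move=> z1 dB; set f := fun v => _.
have z0 : 0 < z by lra.
have ff : fin_supp f.
  by exists [:: u] => w; rewrite inE /f => /negPf ->.
have nf : ip f f = 1.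
  rewrite /ip (isumE (r := [:: u])) // ?big_seq1 /f ?eqxx ?mulr1 // => w.
  by rewrite inE => /negPf ->; rewrite mul0r.
have lin_iter m (c : R) h h' : iter m markov (fun v => c * (h v + h' v)) =
    (fun v => c * (iter m markov h v + iter m markov h' v)).
  elim: m => //= m ->; apply/funext => w; rewrite /markov -big_split /= mulr_sumr.
  by apply: eq_bigr => g _; ring.
pose Z j := z ^+ j + z ^- j.
have Z0 j : 0 < Z j by rewrite addr_gt0 ?invr_gt0 ?exprn_gt0.
have base j : `|cheb f j v| <= z ^- d * Z j.
  have [jd|dj] := ltnP j d.
    rewrite cheb_support ?dB // normr0 mulr_ge0 ?invr_ge0 ?exprn_ge0 ?ltW //.
  apply: (@le_trans _ _ 1).
    rewrite -(@ler_pXn2r _ 2) ?nnegrE // expr1n -normrX ger0_norm ?sqr_ge0 //.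
    rewrite -nf; apply: le_trans (cheb_norm j ff); rewrite expr2.
    have fc : fin_supp (cheb f j).
      exists [seq (u + w%:Z - (B * j)%N%:Z) | w <- iota 0 (2 * (B * j)).+1] => w wn.
      apply: cheb_support; rewrite ltNge; apply: contra wn => wB.
      by apply/mapP; exists (absz (w - u + (B * j)%N%:Z)); rewrite ?mem_iota; lia.
    apply: (@isum_ge_term _ (fun w => cheb f j w * cheb f j w)).
      exact: fin_suppMl.
    by move=> w; rewrite -expr2 sqr_ge0.
  rewrite mulrDr -[X in X <= _]addr0; apply: lerD; last first.
    by rewrite mulr_ge0 ?invr_ge0 ?exprn_ge0 ?ltW.
  by rewrite ler_pdivlMl ?exprn_gt0 // mulr1 ler_weXn2l.
have zn : z != 0 by rewrite gt_eqF.
have Zrec j : 1 / 2 * (Z j.+2 + Z j) = (z + z^-1) / 2 * Z j.+1.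
  by rewrite /Z !exprS !invfM; field; rewrite expf_neq0.
have key m j : `|iter m markov (cheb f j) v| <= z ^- d * Z j * ((z + z^-1) / 2) ^+ m.
  elim: m j => [|m IH] j; first by rewrite expr0 mulr1; exact: base.
  rewrite iterSr; case: j => [|j].
    rewrite markov_cheb0; apply: le_trans (IH 1%N) _.
    by rewrite /Z expr1 expr0 invr1 exprS le_eqVlt; apply/orP; left; apply/eqP;
       move: (z ^- d) (z + z^-1) => x y; field.
  rewrite markov_cheb lin_iter normrM ger0_norm; last by lra.
  apply: (@le_trans _ _ (1 / 2 * (z ^- d * Z j.+2 * ((z + z^-1) / 2) ^+ m +
      z ^- d * Z j * ((z + z^-1) / 2) ^+ m))).
    rewrite ler_pM2l; last by lra.
    apply: (@le_trans _ _ (`|iter m markov (cheb f j.+2) v| +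
        `|iter m markov (cheb f j) v|)); first exact: ler_normD.
    by apply: lerD; apply: IH.
  rewrite exprS le_eqVlt; apply/orP; left; apply/eqP.
  rewrite (_ : z ^- d * Z j.+1 * _ = z ^- d * ((z + z^-1) / 2 * Z j.+1) *
     ((z + z^-1) / 2) ^+ m); last by ring.
  by rewrite -Zrec; ring.
have := key n 0%N; rewrite cheb0 /Z expr0 invr1 => /le_trans; apply.
by rewrite le_eqVlt; apply/orP; left; apply/eqP; ring.
Qed.

End Bound.
End Carne.

(** * Walks in the full group have sublinear entropy *)

Section SublinearEntropy.
Context (R : realType) (A : Type) (w : int -> A) (lin : linear_complexity w).
Context (G : groupType) (s : seq G) (mu : G -> R) (rho : G -> zperm).
Context (us : uniq s) (mu_gt0 : forall g, g \in s -> 0 < mu g).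
Context (mu1 : \sum_(g <- s) mu g = 1).
Context (sV : forall g, g \in s -> (g^-1)%g \in s).
Context (muV : forall g, mu (g^-1)%g = mu g).
Context (rho1 : rho 1%g = 1%g).
Context (rhoM : forall g h, rho (g * h)%g = (rho g * rho h)%g).
Context (rho_inj : injective rho).
Context (rho_loc : forall g, g \in s -> locperm w (rho g)).

Let wx := wexp s mu.

Definition displaced (L : nat) (h : zperm) := forall v, `|h v - v| <= L%:Z.

Lemma locperm_at_le r r' h : (r <= r')%N -> locperm_at w r h -> locperm_at w r' h.
Proof. by move=> rr lh n n' nn; apply: lh; apply: agree_le nn. Qed.

Lemma steps_bound : exists B r : nat, [/\ (0 < B)%N,
  forall g, g \in s -> displaced B (rho g)
  & forall g, g \in s -> locperm_at w r (rho g)].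
Proof.
elim: s rho_loc => [|g s' IH] loc; first by exists 1%N, 0%N.
have [B [r [B0 dB lr]]] := IH (fun h hs => loc h (mem_behead (s := g :: s') hs)).
have lg := loc g (mem_head _ _).
have [B' gB'] := locperm_bounded lin lg; case: lg => r' lg.
exists (maxn B B'), (maxn r r'); split=> [|h|h]; first by lia.
  rewrite inE => /predU1P[->|/dB hB] v; first by have := gB' v; lia.
  by have := hB v; lia.
rewrite inE => /predU1P[->|/lr]; first by apply: locperm_at_le lg; lia.
by apply: locperm_at_le; lia.
Qed.

Section Bounds.
Context (B r0 C : nat) (B0 : (0 < B)%N).
Context (dB : forall g, g \in s -> displaced B (rho g)).
Context (lr : forall g, g \in s -> locperm_at w r0 (rho g)).
Context (Cw : forall r, exists2 V : seq int,
  (size V <= C * r.+1)%N & patterns_bound w r V).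

Lemma reach_local m x : x \in reach s m ->
  locperm_at w (r0 + B * m) (rho x) /\ displaced (B * m) (rho x).
Proof.
elim: m x => [x|m IH _ /allpairsP[[g x] /= [gs /IH[lx dx] ->]]].
  rewrite inE => /eqP ->; rewrite rho1; split=> [n n' _|v]; rewrite !zp1; lia.
rewrite rhoM; split.
  by apply: (locperm_at_le _ (locperm_atM (lr gs) lx dx)); rewrite mulnS; lia.
move=> v; rewrite zpM mulnS; have := dB gs (rho x v); have := dx v; lia.
Qed.

(** The good event, described by the elements that it reaches rather than by
    paths. *)
Fixpoint tame (L n : nat) (x : G) : Prop :=
  if n is n'.+1 then displaced L (rho x) /\
    exists g y, [/\ g \in s, tame L n' y & x = (g * y)%g]
  else x = 1%g.

Lemma tame_local L n x : tame L n x ->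
  locperm_at w (r0 + L) (rho x) /\ displaced L (rho x).
Proof.
elim: n x => [_ ->|n IH x [dx [g [y [gs /IH[ly dy] xE]]]]].
  by rewrite rho1; split=> [n n' _|v]; rewrite !zp1; lia.
split=> //; rewrite xE rhoM.
by apply: (locperm_at_le _ (locperm_atM (lr gs) ly dy)); lia.
Qed.

(** A tame element is determined by its displacements, at most [L] in absolute
    value, at one representative of each pattern of radius [r0 + L]. *)
Lemma tame_count L n :
  (size [seq x <- undup (reach s n) | `[< tame L n x >]]
     <= (2 * L).+1 ^ (C * (r0 + L).+1))%N.
Proof.
have [V sV' VP] := Cw (r0 + L); set l := [seq x <- _ | _].
pose key x : {ffun 'I_(size V) -> 'I_(2 * L).+1} :=
  [ffun i : 'I_(size V) => inord (absz (rho x (nth 0 V i) - nth 0 V i + L%:Z))].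
have ul : uniq l by rewrite filter_uniq ?undup_uniq.
have lP x : x \in l -> tame L n x by rewrite mem_filter => /andP[/asboolP].
have ukl : uniq (map key l).
  rewrite map_inj_in_uniq // => x y /lP /tame_local[lx dx] /lP /tame_local[ly dy] xy.
  apply: rho_inj; apply: zpermP => v; have [u uV uv] := VP v.
  rewrite (lx _ _ uv) (ly _ _ uv); congr (_ + _).
  have iu : (index u V < size V)%N by rewrite index_mem.
  have /(congr1 val) := congr1 (fun f : {ffun _ -> _} => f (Ordinal iu)) xy.
  rewrite !ffunE /= nth_index //.
  have dxu := dx u; have dyu := dy u; rewrite !inordK; lia.
rewrite -(size_map key) -(card_uniqP ukl).
apply: leq_trans (max_card _) _; rewrite card_ffun !card_ord.
by rewrite leq_pexp2l.
Qed.

Lemma wexp_markov m v F : wx m (fun x => F (rho x v)) =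
  iter m (markov s mu rho) F v.
Proof.
elim: m F => [|m IH] F; first by rewrite /= rho1 zp1.
rewrite iterSr -IH /wx /= /markov (wexp_sum mu_gt0 mu1).
apply: eq_bigr => g _; rewrite -wexpZ; apply: eq_wexp => // x _.
by rewrite rhoM.
Qed.

Definition tail_bound (d n : nat) (z : R) : R :=
  (C * (r0 + B * n).+1)%N%:R *
  ((2 * (B * n)).+1%:R * (2 * z ^- d * ((z + z^-1) / 2) ^+ n)).

(** Union bound over one representative [v] of each pattern of radius
    [r0 + B * m], which determines the action of the walk at time [m], and over
    the possible images of [v]. *)
Lemma displaced_tail (d m n : nat) (z : R) : 1 <= z -> (m <= n)%N ->
  wx m (fun x => (~~ `[< displaced (B * d) (rho x) >])%:R) <= tail_bound d n z.
Proof.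
move=> z1 mn; have [V sVC VP] := Cw (r0 + B * m).
pose K := iota 0 (2 * (B * m)).+1.
pose u (v : int) (k : nat) : int := v + k%:Z - (B * m)%N%:Z.
pose far v k : R := ((B * d)%N%:Z < `|v - u v k|)%R%:R.
have r1 : 1 <= (z + z^-1) / 2.
  have z0 : 0 < z by lra.
  rewrite ler_pdivlMr // mul1r -subr_ge0.
  rewrite (_ : _ - _ = (z - 1) ^+ 2 / z); last by field; rewrite gt_eqF.
  by rewrite divr_ge0 ?sqr_ge0 // ltW.
pose T : R := 2 * z ^- d * ((z + z^-1) / 2) ^+ n.
have T0 : 0 <= T by rewrite !mulr_ge0 ?invr_ge0 ?exprn_ge0 //; lra.
apply: (@le_trans _ _ (wx m (fun x => \sum_(v <- V) \sum_(k <- K)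
    far v k * (rho x v == u v k)%:R))).
  apply: le_wexp => // x /reach_local[lx dx].
  have pos v : 0 <= \sum_(k <- K) far v k * (rho x v == u v k)%:R.
    by apply: sumr_ge0 => k _; rewrite mulr_ge0 ?ler0n.
  case: asboolP => /= [_|nd]; first by apply: sumr_ge0.
  have [v vV vd] : exists2 v, v \in V & (B * d)%N%:Z < `|rho x v - v|.
    apply: contrapT => nv; apply: nd => y; have [v vV vy] := VP y.
    rewrite (lx _ _ vy) leNgt; apply/negP => yd; apply: nv; exists v => //.
    by rewrite (_ : rho x v - v = rho x v + (y - v) - y) //; lia.
  rewrite (big_rem v) //=; rewrite -[leLHS]addr0 lerD ?sumr_ge0 //.
  pose k := absz (rho x v - v + (B * m)%N%:Z).
  have uk : rho x v = u v k by rewrite /u /k; have := dx v; lia.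
  rewrite (big_rem k) /=; last first.
    by rewrite mem_iota /k; have := dx v; lia.
  rewrite -uk eqxx /far -uk mulr1 distrC vd -[leLHS]addr0 lerD //.
  by apply: sumr_ge0 => k' _; rewrite mulr_ge0 ?ler0n.
rewrite /wx (wexp_sum mu_gt0 mu1) -/wx.
have term v k : wx m (fun x => far v k * (rho x v == u v k)%:R) <= T.
  rewrite /wx wexpZ -/wx /far; case: ltP => [far_uv|_]; last by rewrite mul0r.
  rewrite mul1r (wexp_markov m v (fun y => (y == u v k)%:R)).
  apply: le_trans (ler_norm _) _.
  apply: (@le_trans _ _ (2 * z ^- d * ((z + z^-1) / 2) ^+ m)).
    apply: (@carne R G s mu rho us _ mu1 sV muV _ B) => //.
    - by move=> g gs; apply: ltW; apply: mu_gt0.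
    - by move=> g; apply/esym/mulg1_eq; rewrite -rhoM mulgV rho1.
    - by move=> g x gs; apply: dB.
    - by move=> j jd; apply: le_lt_trans far_uv; rewrite lez_nat leq_mul2l ltnW ?orbT.
  rewrite ler_wpM2l ?mulr_ge0 ?invr_ge0 ?exprn_ge0 //; try lra.
  by rewrite ler_weXn2l.
apply: (@le_trans _ _ (\sum_(v <- V) \sum_(k <- K) T)).
  by apply: ler_sum => v _; rewrite /wx (wexp_sum mu_gt0 mu1); apply: ler_sum => k _; apply: term.
rewrite /tail_bound -/T !big_const_seq !count_predT !iter_addr_0 size_iota.
rewrite -[T *+ _]mulr_natl -[X in X <= _]mulr_natl.
have V1 : (size V <= C * (r0 + B * n).+1)%N 
  by apply: leq_trans sVC _; rewrite leq_mul2l ltnS leq_add2l leq_mul2l mn !orbT.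
have K1 : ((2 * (B * m)).+1 <= (2 * (B * n)).+1)%N
  by rewrite ltnS !leq_mul2l mn !orbT.
apply: ler_pM; first exact: ler0n.
- by rewrite mulr_ge0.
- by rewrite ler_nat.
- by rewrite ler_wpM2r // ler_nat.
Qed.

Lemma wild_bound (d n : nat) (z : R) : 1 <= z ->
  wx n (fun x => (~~ `[< tame (B * d) n x >])%:R) <= n%:R * tail_bound d n z.
Proof.
move=> z1.
suff : forall m, (m <= n)%N ->
    wx m (fun x => (~~ `[< tame (B * d) m x >])%:R) <= m%:R * tail_bound d n z.
  exact.
elim=> [_|m IH mn].
  by rewrite /wx /= asboolT // mul0r.
rewrite -natr1 mulrDl mul1r.
apply: (@le_trans _ _ (wx m.+1 (fun x => (~~ `[< displaced (B * d) (rho x) >])%:R) +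
    wx m (fun x => (~~ `[< tame (B * d) m x >])%:R))); last first.
  by rewrite addrC lerD ?displaced_tail // IH // ltnW.
rewrite /wx -[X in _ + X]mul1r -[X in _ + X * _]mu1 mulr_suml /= -big_split /=.
rewrite big_seq [leRHS]big_seq; apply: ler_sum => g gs.
rewrite -mulrDr ler_pM2l ?mu_gt0 // -wexpD; apply: le_wexp => // x xm.
case: (asboolP (displaced _ _)) => [dgx|_] /=; last first.
  move: `[< _ >] `[< _ >] => b b'; case: b; case: b' => /=; rewrite ?(mulr0n, mulr1n); lra.
rewrite add0r ler_nat; case: (asboolP (tame _ m x)) => [tx|_]; last exact: leq_b1.
by rewrite asboolT //; split=> //; exists g, x.
Qed.

Lemma ent_tail (d n : nat) (z : R) : 1 <= z ->
  ent s mu n <= ln (2 * ((2 * (B * d)).+1 ^ (C * (r0 + B * d).+1))%N%:R) +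
    n%:R * tail_bound d n z * ln (2 * (size s)%:R ^+ n).
Proof.
move=> z1; have s0 : (0 < size s)%N.
  case: (s) mu1 => // /eqP; rewrite big_nil eq_sym oner_eq0 //.
have := @ent_le R G s mu us mu_gt0 mu1 n (fun x => `[< tame (B * d) n x >]) _ _ s0
  (tame_count (B * d) n).
move=> /(_ ltac:(by rewrite expn_gt0)) /le_trans; apply.
rewrite lerD2l ler_wpM2r ?wild_bound // ln_ge0 //.
rewrite -natrX -natrM ler1n muln_gt0 /= expn_gt0 s0 //.
Qed.

End Bounds.

(** The probability of the bad event is of order [2 ^ - q] up to a power of [q];
    an exponent that is a multiple of 13 makes the comparison elementary. *)
Lemma pow13_le (t : nat) : ((13 * t) ^ 13 <= 13 ^ 13 * 2 ^ (13 * t))%N.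
Proof. by rewrite expnMn leq_mul2l /= mulnC expnM leq_exp2r // ltnW // ltn_expl. Qed.

Lemma bernoulli_ineq (x : R) n : -1 <= x -> 1 + n%:R * x <= (1 + x) ^+ n.
Proof.
move=> x1; elim: n => [|n IH]; first by rewrite mul0r addr0 expr0.
rewrite exprS; apply: (@le_trans _ _ ((1 + x) * (1 + n%:R * x))).
  rewrite -natr1 -subr_ge0 (_ : _ - _ = n%:R * x ^+ 2); last by ring.
  by rewrite mulr_ge0 ?sqr_ge0.
by rewrite ler_wpM2l //; lra.
Qed.

Section Scale.
Context (q : nat) (q0 : (0 < q)%N).
Let z : R := 1 + ((q ^ 2)%N%:R)^-1.

Let Q0 m : 0 < (q ^ m)%N%:R :> R. Proof. by rewrite ltr0n expn_gt0 q0. Qed.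

Let z1 : 1 <= z. Proof. by rewrite lerDl invr_ge0 ltW. Qed.

Lemma scale_decay : z ^- (q ^ 3) <= (2 ^+ q)^-1.
Proof.
have zq : 2 <= z ^+ (q ^ 2).
  have := @bernoulli_ineq ((q ^ 2)%N%:R)^-1 (q ^ 2).
  rewrite mulfV ?gt_eqF //; apply.
  by rewrite (@le_trans _ _ 0) ?invr_ge0 ?ltW //; lra.
rewrite lef_pV2 ?posrE ?exprn_gt0 //; last by apply: lt_le_trans z1.
rewrite (expnSr q 2) (exprM z (q ^ 2) q).
apply: lerXn2r => //; rewrite nnegrE; first by lra.
by apply: le_trans zq; lra.
Qed.

Lemma scale_growth : ((z + z^-1) / 2) ^+ (q ^ 4) <= 2.
Proof.
pose y : R := (2 * (q ^ 4)%N%:R)^-1.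
have z0 : 0 < z by apply: lt_le_trans z1.
have y0 : 0 < y by rewrite invr_gt0 mulr_gt0.
have ny : (q ^ 4)%N%:R * y = 1 / 2.
  by rewrite /y; move: (Q0 4); move: (_%:R) => Y Y0; field; rewrite gt_eqF.
have y1 : y <= 1.
  rewrite invf_le1 ?mulr_gt0 //; have : 1 <= (q ^ 4)%N%:R :> R by rewrite ler1n expn_gt0 q0.
  lra.
have zy : (z + z^-1) / 2 <= 1 + y.
  rewrite -subr_ge0 (_ : _ - _ = (2 * y * z - (z - 1) ^+ 2) / (2 * z)); last first.
    by field; rewrite gt_eqF.
  apply: divr_ge0; last by rewrite mulr_ge0 // ltW.
  rewrite subr_ge0.
  have -> : (z - 1) ^+ 2 = 2 * y.
    rewrite /z addrC addKr /y invfM mulrA mulfV ?mul1r ?pnatr_eq0 //.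
    by rewrite exprVn -natrX -expnM.
  by rewrite ler_peMr ?mulr_ge0 // ltW.
apply: (@le_trans _ _ ((1 + y) ^+ (q ^ 4))).
  rewrite ler_pXn2r ?expn_gt0 ?q0 ?nnegrE //; last by lra.
  by rewrite divr_ge0 // addr_ge0 ?invr_ge0 ?ltW.
have b := @bernoulli_ineq (- y) (q ^ 4) ltac:(lra).
rewrite mulrN ny in b.
have Y0 : 0 <= (1 + y) ^+ (q ^ 4) by rewrite exprn_ge0 //; lra.
have : (1 + y) ^+ (q ^ 4) * (1 - y) ^+ (q ^ 4) <= 1.
  rewrite -exprMn (_ : _ * _ = 1 - y ^+ 2); last by ring.
  by rewrite exprn_ile1 // ?subr_ge0 ?gerBl ?sqr_ge0 // expr_le1 // ltW.
have := ler_wpM2l Y0 b; lra.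
Qed.

End Scale.

(** Walking [n = q ^ 4] steps and watching displacements of order
    [q ^ 3 = n ^ (3 / 4)], the good event costs entropy [q ^ 3 log q] and the
    bad one has probability smaller than any power of [q]. *)
Theorem sublinear_entropy e : 0 < e ->
  exists2 n, (0 < n)%N & ent s mu n <= e * n%:R.
Proof.
move=> e0; have [B [r0 [B0 dB lr]]] := steps_bound.
have [C Cw] := lin; set k := size s.
have k0 : (0 < k)%N.
  by rewrite /k; case: (s) mu1 => // /eqP; rewrite big_nil eq_sym oner_eq0.
(* The constant is kept abstract: its value must never be computed. *)
have [D powD] : exists D, forall t, ((13 * t) ^ 13 <= D * 2 ^ (13 * t))%N.
  by exists (13 ^ 13)%N; exact: pow13_le.
pose c := (C * (r0 + B).+1)%N.
pose K3 := (2 + c * (3 * B + 6))%N.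
pose K5 := (c * (3 * B) * 4 * (3 * k) * D)%N.
have [p [p0 p13 Ke]] : exists p, [/\ (0 < p)%N,
    ((p ^ 2) ^ 13 <= D * 2 ^ (p ^ 2))%N & (K3 + K5)%N%:R <= e * p%:R].
  pose t := (Num.bound ((K3 + K5)%N%:R / e)).+1.
  exists (13 * t)%N; split=> //.
    rewrite (_ : (13 * t) ^ 2 = 13 * (13 * t ^ 2))%N; first exact: powD.
    by rewrite expnMn -mulnA.
  have : (K3 + K5)%N%:R / e < (13 * t)%N%:R.
    apply: (@lt_le_trans _ _ (Num.bound ((K3 + K5)%N%:R / e))%:R).
      by apply: archi_boundP; rewrite divr_ge0 ?ler0n // ltW.
    by rewrite ler_nat /t; lia.
  by rewrite ltr_pdivrMr // mulrC => /ltW.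
have [q [qE q13]] : exists q, q = (p ^ 2)%N /\ (q ^ 13 <= D * 2 ^ q)%N.
  by exists (p ^ 2)%N.
have q0 : (0 < q)%N by rewrite qE expn_gt0 p0.
have n0 : (0 < q ^ 4)%N by rewrite expn_gt0 q0.
exists (q ^ 4)%N => //.
pose z : R := 1 + ((q ^ 2)%N%:R)^-1.
have z1 : 1 <= z by rewrite lerDl invr_ge0 ler0n.
have := ent_tail B0 dB lr Cw (q ^ 3) (q ^ 4) z1 => /le_trans; apply.
have lnk (x : nat) : (0 < x)%N -> ln (x%:R : R) <= x%:R.
  by move=> x0; apply/ltW/ln_sublinear; rewrite ltr0n.
have main : ln (2 * ((2 * (B * q ^ 3)).+1 ^ (C * (r0 + B * q ^ 3).+1))%N%:R : R)
    <= K3%:R * (q ^ 3 * p)%N%:R.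
  have lnb : ln ((2 * (B * q ^ 3)).+1%:R : R) <= ((3 * B + 6) * p)%N%:R.
    apply: (@le_trans _ _ (ln ((3 * B)%N%:R * p%:R ^+ 6))).
      rewrite ler_ln ?posrE ?mulr_gt0 ?exprn_gt0 ?ltr0n ?muln_gt0 //.
      rewrite -natrX -natrM ler_nat qE -expnM.
      have : (0 < p ^ (2 * 3))%N by rewrite expn_gt0 p0.
      by move: (p ^ (2 * 3))%N => x; nia.
    rewrite lnM ?posrE ?exprn_gt0 ?ltr0n ?muln_gt0 // lnXn ?ltr0n //.
    have l1 := lnk (3 * B)%N ltac:(by rewrite muln_gt0).
    have l2 := lnk p p0.
    apply: (@le_trans _ _ ((3 * B)%N%:R + p%:R *+ 6)).
      by apply: lerD => //; exact: ler_wMn2r.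
    by rewrite -[X in _ + X]mulr_natr -natrM -natrD ler_nat; nia.
  rewrite lnM ?posrE ?ltr0n ?expn_gt0 // natrX lnXn ?ltr0n //.
  have l2 := lnk 2%N isT.
  apply: (@le_trans _ _ (2%:R + ((3 * B + 6) * p)%N%:R *+ (C * (r0 + B * q ^ 3).+1))).
    by apply: lerD => //; exact: ler_wMn2r.
  rewrite -[X in _ + X]mulr_natr -!natrM -natrD ler_nat /K3.
  have q30 : (0 < q ^ 3)%N by rewrite expn_gt0 q0.
  have mx : (C * (r0 + B * q ^ 3).+1 <= c * q ^ 3)%N.
    by rewrite /c -mulnA leq_mul2l; apply/orP; right; move: (q ^ 3)%N q30 => x x0; nia.
  apply: (@leq_trans (2 + (3 * B + 6) * p * (c * q ^ 3))).
    by rewrite leq_add2l leq_mul2l mx orbT.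
  have : (0 < q ^ 3 * p)%N by rewrite muln_gt0 q30.
  by move: (3 * B + 6)%N (q ^ 3)%N => y x; nia.
have bad : (q ^ 4)%N%:R * tail_bound B r0 C (q ^ 3) (q ^ 4) z *
    ln (2 * k%:R ^+ (q ^ 4)) <= K5%:R * (q ^ 3 * p)%N%:R.
  have n1 : (0 < q ^ 4)%N := n0.
  have lnn : ln (2 * k%:R ^+ (q ^ 4) : R) <= (3 * k * q ^ 4)%N%:R.
    rewrite lnM ?posrE ?exprn_gt0 ?ltr0n // lnXn ?ltr0n //.
    have l1 := lnk 2%N isT; have l2 := lnk k k0.
    apply: (@le_trans _ _ (2%:R + k%:R *+ (q ^ 4))).
      by apply: lerD => //; exact: ler_wMn2r.
    rewrite -[X in _ + X]mulr_natr -natrM -natrD ler_nat.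
    by move: (q ^ 4)%N n1 => x x0; nia.
  have lnn0 : 0 <= ln (2 * k%:R ^+ (q ^ 4) : R).
    by rewrite ln_ge0 // -natrX -natrM ler1n muln_gt0 expn_gt0 k0.
  have T : tail_bound B r0 C (q ^ 3) (q ^ 4) z <=
      (c * q ^ 4)%N%:R * ((3 * B * q ^ 4)%N%:R * (4 * (2 ^+ q)^-1)).
    have z0 : 0 < z by lra.
    have zV : 0 <= z^-1 by rewrite invr_ge0; lra.
    have zz0 : 0 <= (z + z^-1) / 2 by lra.
    have zd0 : 0 <= 2 * z ^- (q ^ 3).
      by rewrite mulr_ge0 // invr_ge0 exprn_ge0 // ltW.
    apply: ler_pM.
    - exact: ler0n.
    - by rewrite mulr_ge0 // mulr_ge0 // exprn_ge0.
    - rewrite ler_nat /c -mulnA leq_mul2l; apply/orP; right.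
      by rewrite mulSn mulnDl -add1n !addnA leq_add2r leq_add // leq_pmulr.
    apply: ler_pM.
    - exact: ler0n.
    - by rewrite mulr_ge0 // exprn_ge0.
    - have : (0 < B * q ^ 4)%N by rewrite muln_gt0 B0.
      by rewrite ler_nat -mulnA; move: (B * q ^ 4)%N; clear => x; lia.
    rewrite (_ : 4 * _ = (2 * (2 ^+ q)^-1) * 2); last by ring.
    apply: ler_pM => //; first exact: exprn_ge0.
      by rewrite ler_wpM2l // scale_decay.
    exact: scale_growth.
  apply: (@le_trans _ _ ((q ^ 4)%N%:R * ((c * q ^ 4)%N%:R *
      ((3 * B * q ^ 4)%N%:R * (4 * (2 ^+ q)^-1))) * (3 * k * q ^ 4)%N%:R)).
    apply: (@le_trans _ _ ((q ^ 4)%N%:R * ((c * q ^ 4)%N%:R *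
      ((3 * B * q ^ 4)%N%:R * (4 * (2 ^+ q)^-1))) * ln (2 * k%:R ^+ (q ^ 4)))).
      by rewrite ler_wpM2r // ler_wpM2l.
    rewrite ler_wpM2l //; do !rewrite mulr_ge0 //.
    by rewrite invr_ge0 exprn_ge0.
  rewrite (_ : _ * _ = (q ^ 4 * (c * q ^ 4) * (3 * B * q ^ 4) * 4 *
      (3 * k * q ^ 4))%N%:R / 2 ^+ q); last by rewrite !natrM; ring.
  rewrite ler_pdivrMr ?exprn_gt0 // -natrX -!natrM ler_nat.
  rewrite (_ : (_ * _)%N = (c * (3 * B) * 4 * (3 * k) * (q ^ 3 * q ^ 13))%N); last first.
    rewrite (_ : (q ^ 3 * q ^ 13 = q ^ 4 * q ^ 4 * q ^ 4 * q ^ 4)%N).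
      by move: (q ^ 4)%N; clearbody c; clearbody k; clear => x; lia.
    by rewrite -!expnD.
  rewrite /K5; move: (c * (3 * B) * 4 * (3 * k))%N => x.
  apply: (@leq_trans (x * (q ^ 3 * (D * 2 ^ q)))).
    by rewrite !leq_mul2l q13 !orbT.
  rewrite (_ : (x * D * (q ^ 3 * p) * 2 ^ q = x * (q ^ 3 * (D * 2 ^ q)) * p)%N).
    exact: leq_pmulr.
  by move: (q ^ 3)%N (2 ^ q)%N => y y'; clear; lia.
apply: (le_trans (lerD main bad)).
rewrite -mulrDl -natrD (_ : (q ^ 4 = (q ^ 3 * p) * p)%N); last first.
  by rewrite -mulnA mulnn -qE -expnSr.
rewrite [in leRHS]natrM mulrC [leRHS]mulrCA.
by rewrite ler_wpM2l.
Qed.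

End SublinearEntropy.

(** * The Liouville property and amenability *)

Section HarmonicFunctions.
Context (R : realType) (G : groupType) (s : seq G) (mu : G -> R).
Context (us : uniq s) (mu_gt0 : forall g, g \in s -> 0 < mu g).
Context (mu1 : \sum_(g <- s) mu g = 1).
Context (mixing : forall d : R, 0 < d -> exists n, forall g F, g \in s ->
  (forall x, `|F x| <= 1) ->
  `|wexp s mu n (fun x => F (g * x)%g) - wexp s mu n.+1 F| <= d).

(** Harmonicity concerns right multiplication and the walk grows on the left, but
    both describe the same sums over words. *)
Lemma mean_value n (f : G -> R) :
  (forall x, f x = \sum_(g <- s) f (x * g)%g * mu g) ->
  forall x, wexp s mu n (fun y => f (x * y)%g) = f x.
Proof.
move=> fh; elim: n => [|n IH] x /=; first by rewrite mulg1.
rewrite [RHS]fh; apply: eq_bigr => g _; rewrite mulrC -IH; congr (_ * _).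
by apply: eq_wexp => // y _; rewrite mulgA.
Qed.

(** [f (x g)] is the mean of [f (x .)] for the law of [g X_n] and [f x] its mean
    for the law of [X_(n+1)]. *)
Lemma harmonic_step (f : G -> R) (M : R) : (forall x, `|f x| <= M) ->
  (forall x, f x = \sum_(g <- s) f (x * g)%g * mu g) ->
  forall x g, g \in s -> f (x * g)%g = f x.
Proof.
move=> fM fh x g gs; apply/eqP; rewrite -subr_eq0 -normr_le0.
pose M1 := M + 1; have M0 : 0 < M1.
  by have := fM 1%g; have := normr_ge0 (f 1%g); rewrite /M1; lra.
apply/ler_addgt0Pr => e e0; rewrite add0r.
have eM : 0 < e / M1 by rewrite divr_gt0.
have [n nP] := mixing eM.
have F1 y : `|f (x * y)%g / M1| <= 1.
  rewrite normrM (gtr0_norm (_ : 0 < M1^-1)) ?invr_gt0 // ler_pdivrMr // mul1r.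
  by have := fM (x * y)%g; rewrite /M1; lra.
have := nP g (fun y => f (x * y)%g / M1) gs F1.
have E m F : wexp s mu m (fun y => F y / M1) = wexp s mu m F / M1.
  by rewrite mulrC -wexpZ; apply: eq_wexp => // y _; rewrite mulrC.
rewrite !E (mean_value n.+1 fh).
rewrite (_ : wexp s mu n _ = f (x * g)%g); last first.
  by rewrite -(mean_value n fh); apply: eq_wexp => // y _; rewrite mulgA.
rewrite -mulrBl normrM (gtr0_norm (_ : 0 < M1^-1)) ?invr_gt0 //.
by rewrite ler_pM2r ?invr_gt0.
Qed.

End HarmonicFunctions.

Section LocalGroup.
Context (R : realType) (A : Type) (w : int -> A) (lin : linear_complexity w).
Context (S : set zperm) (S_loc : forall g, gen_set S g -> locperm w g).

Let H := generated S.

Theorem local_liouville : liouville R H.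
Proof.
move=> mu [mu0 fin_mu mu1] mu_sym f [M fM] fh.
pose K := generated (mass_support mu).
have [l ul lE] : exists2 l : seq H, uniq l & mass_support mu = [set` l].
  have /finite_seqP[l lE] := fin_mu; exists (undup l); first exact: undup_uniq.
  by rewrite lE; apply/seteqP; split=> x /=; rewrite mem_undup.
have muE x : (mu x != 0) = (x \in l).
  apply/idP/idP => [x0|xl]; first by have : mass_support mu x by []; rewrite lE.
  by have : [set` l] x by []; rewrite -lE.
have l_gen x : x \in l -> x \in gen_set (mass_support mu).
  by rewrite -muE => x0; rewrite inE => L [_]; apply.
pose s : seq K := pmap insub l.
have sE (k : K) : (k \in s) = (val k \in l) by rewrite mem_pmap_sub.
have us : uniq s by apply: pmap_sub_uniq.
pose muK (k : K) := mu (val k).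
have muK_gt0 k : k \in s -> 0 < muK k.
  by rewrite sE -muE => k0; rewrite lt_def k0 mu0.
have mulE : \sum_(g <- l) mu g = 1.
  rewrite -mu1 (fsbigE l) //; first by apply: eq_bigl => x; rewrite in_setT.
  by move=> x _; rewrite -muE negbK => /eqP.
have muK1 : \sum_(k <- s) muK k = 1.
  rewrite -mulE -(big_map val xpredT mu); apply: perm_big.
  apply: uniq_perm => //; first by rewrite map_inj_uniq //; apply: val_inj.
  move=> x; apply/mapP/idP => [[k ks ->]|xl]; first by rewrite -sE.
  by exists (Sub x (l_gen x xl) : K) => //; rewrite sE.
have sV k : k \in s -> (k^-1)%g \in s.
  by rewrite !sE -!muE /= -mu_sym.
have muKV k : muK (k^-1)%g = muK k by rewrite /muK /= -mu_sym.
pose rho (k : K) : zperm := val (val k).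
have rho_loc k : k \in s -> locperm w (rho k).
  by move=> _; apply: S_loc; have := valP (val k); rewrite inE.
have rho_inj : injective rho by move=> x y /val_inj/val_inj.
have rho1 : rho 1%g = 1%g by [].
have rhoM k k' : rho (k * k')%g = (rho k * rho k')%g by [].
have slow := @sublinear_entropy R A w lin K s muK rho us muK_gt0 muK1 sV muKV
  rho1 rhoM rho_inj rho_loc.
have mixing := @slow_entropy_mixing R K s muK us muK_gt0 muK1 slow.
have fh' x : f x = \sum_(k <- s) f (x * k)%g * muK k.
  rewrite fh (fsbigE s) //; first by apply: eq_bigl => k; rewrite in_setT.
  by move=> k _; rewrite sE -muE negbK => /eqP ->; rewrite mulr0.
have step := @harmonic_step R K s muK muK_gt0 mixing f M fM fh'.
pose L : set H := [set h | exists2 k : K, val k = h & forall x, f (x * k)%g = f x].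
have subL : is_subgroup L.
  split; first by exists 1%g => // x; rewrite mulg1.
    move=> _ _ [k <- fk] [k' <- fk']; exists (k * k')%g => // x.
    by rewrite mulgA fk' fk.
  by move=> _ [k <- fk]; exists (k^-1)%g => // x; rewrite -fk mulgVK.
have supL : mass_support mu `<=` L.
  move=> h; rewrite lE /= => hl; exists (Sub h (l_gen h hl) : K) => // x.
  by apply: step; rewrite sE.
have const k x : f (x * k)%g = f x.
  have : gen_set (mass_support mu) (val k) by have := valP k; rewrite inE.
  by move=> /(_ L) [] // k' /val_inj <-.
by move=> x y; rewrite -(const (x^-1 * y)%g x) mulVKg.
Qed.

End LocalGroup.

(** ** Amenability *)

(** Compactness of [[0, 1]], applied to the image of the ultrafilter. *)
Lemma ultra_lim (R : realType) (U : set_system nat) (u : nat -> R) :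
  UltraFilter U -> (forall i, 0 <= u i <= 1) ->
  exists l : R, forall e, 0 < e -> U [set i | `|u i - l| < e].
Proof.
move=> UU u01; pose F : set_system R := [set B | U (u @^-1` B)].
have FF : ProperFilter F.
  split; first by move=> F0; have /filter_ex[] : U (u @^-1` set0) := F0.
  split; [exact: filterT|move=> P Q; exact: filterI|].
  by move=> P Q PQ; apply: filterS => i /PQ.
have ultraF : UltraFilter F.
  split=> // G GG FG; apply/seteqP; split=> // B GB.
  have [//|nB] := in_ultra_setVsetC (u @^-1` B) UU.
  have GnB : G (~` B) by apply: FG.
  by have /filter_ex[? []] : G (B `&` ~` B) by exact: filterI.
have := @segment_compact R 0 1; rewrite compact_ultra => /(_ F ultraF).
have F01 : F [set` `[0, 1]].
  by rewrite /F /=; apply: filterS filterT => i _ /=; rewrite in_itv /= u01.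
move=> /(_ F01) [l [_ Fl]]; exists l => e e0.
have : F (ball (l : R) e) by apply: Fl; exact: nbhsx_ballx.
by rewrite /F /=; apply: filterS => i; rewrite /ball /= distrC.
Qed.

Section Amenability.
Context (R : realType) (G : groupType) (s : seq G) (mu : G -> R).
Context (mu_gt0 : forall g, g \in s -> 0 < mu g).
Context (mu1 : \sum_(g <- s) mu g = 1).
Context (mixing : forall d : R, 0 < d -> exists n, forall g F, g \in s ->
  (forall x, `|F x| <= 1) ->
  `|wexp s mu n (fun x => F (g * x)%g) - wexp s mu n.+1 F| <= d).
Context (s1 : 1%g \in s) (s_gen : gen_set [set` s] = [set: G]).

(** Averaging over the walk is asymptotically invariant (Reiter's condition);
    an ultrafilter turns the averages into an invariant mean. *)
Theorem mixing_amenable : amenable R G.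
Proof.
pose d i : R := i.+1%:R^-1.
have d0 i : 0 < d i by rewrite invr_gt0 ltr0n.
have [n nP] := boolp.choice (fun i => mixing (d0 i)).
pose ind (A : set G) (x : G) : R := (`[< A x >])%:R.
have ind1 A x : `|ind A x| <= 1.
  by rewrite /ind normr_nat lern1 leq_b1.
pose m i A := wexp s mu (n i) (ind A).
have m01 A i : 0 <= m i A <= 1.
  apply/andP; split.
    by rewrite -(wexp_cst mu1 (n i) 0); apply: le_wexp => // x _; rewrite ler0n.
  rewrite -(wexp_cst mu1 (n i) 1); apply: le_wexp => // x _.
  by rewrite /ind lern1 leq_b1.
have invm i g A : g \in s -> `|m i [set (g * x)%g | x in A] - m i A| <= 2 * d i.
  move=> gs; set gA := [set _ | _ in _].
  have indg x : ind gA (g * x)%g = ind A x.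
    congr (nat_of_bool _)%:R; apply/asboolP/asboolP => [[y Ay /mulgI <-]//|Ax].
    by exists x.
  have h1 := nP i g (ind gA) gs (ind1 gA).
  have h2 := nP i 1%g (ind gA) s1 (ind1 gA).
  have e1 : wexp s mu (n i) (fun x => ind gA (g * x)%g) = m i A.
    by apply: eq_wexp => // x _.
  have e2 : wexp s mu (n i) (fun x => ind gA (1 * x)%g) = m i gA.
    by apply: eq_wexp => // x _; rewrite mul1g.
  rewrite e1 distrC in h1; rewrite e2 in h2.
  have := ler_distD (wexp s mu (n i).+1 (ind gA)) (m i gA) (m i A).
  by lra.
have [U [UU sU]] := ultraFilterLemma (eventually_filter).
have [M MP] := boolp.choice (fun A => ultra_lim UU (m01 A)).
have ex e A B C : 0 < e -> exists i, [/\ d i < e, `|m i A - M A| < e,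
    `|m i B - M B| < e & `|m i C - M C| < e].
  move=> e0; have dU : U [set i | d i < e].
    apply: sU; exists (Num.bound (e^-1)) => // i /= bi.
    rewrite /d invf_plt ?posrE ?ltr0n //.
    apply: (@lt_le_trans _ _ (Num.bound e^-1)%:R).
      by apply: archi_boundP; rewrite invr_ge0 ltW.
    by rewrite ler_nat; apply: leqW.
  have /filter_ex[i [[di Ai] [Bi Ci]]] :
      U (([set i | d i < e] `&` [set i | `|m i A - M A| < e]) `&`
         ([set i | `|m i B - M B| < e] `&` [set i | `|m i C - M C| < e])).
    by apply: filterI; apply: filterI => //; apply: MP.
  by exists i.
have close (x y : R) c : 0 < c -> (forall e, 0 < e -> `|x - y| <= c * e) -> x = y.
  move=> c0 xy; apply/eqP; rewrite -subr_eq0 -normr_le0.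
  apply/ler_addgt0Pr => e e0; rewrite add0r.
  by have := xy (e / c) (divr_gt0 e0 c0); rewrite mulrCA mulfV ?mulr1 // gt_eqF.
have inv1 g A : g \in s -> M [set (g * x)%g | x in A] = M A.
  move=> gs; apply: (close _ _ 4) => // e e0.
  have [i [di h1 h2 _]] := ex e [set (g * x)%g | x in A] A A e0.
  have := invm i g A gs; move: h1 h2; rewrite ltr_norml => /andP[? ?].
  rewrite ltr_norml => /andP[? ?]; rewrite !ler_norml => /andP[? ?].
  by apply/andP; split; lra.
exists M; split.
- move=> A; rewrite leNgt; apply/negP => MA.
  have [i [_ + _ _]] := ex (- M A) A A A ltac:(lra).
  by have /andP[m0 _] := m01 A i; rewrite ltr_norml => /andP[]; lra.
- apply: (close _ _ 1) => // e e0.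
  have [i [_ + _ _]] := ex e [set: G] [set: G] [set: G] e0.
  rewrite (_ : m i _ = 1); last first.
    rewrite -[RHS](wexp_cst mu1 (n i) 1); apply: eq_wexp => // x _.
    by rewrite /ind asboolT.
  by rewrite distrC mul1r => /ltW.
- move=> A B AB; apply: (close _ _ 3) => // e e0.
  have [i [_ + + +]] := ex e (A `|` B) A B e0.
  have -> : m i (A `|` B) = m i A + m i B.
    rewrite -wexpD; apply: eq_wexp => // x _; rewrite /ind.
    case: (asboolP (A x)) => Ax; case: (asboolP (B x)) => Bx.
    + by have : (A `&` B) x by []; rewrite AB.
    + by rewrite asboolT ?addr0 //; left.
    + by rewrite asboolT ?add0r //; right.
    + by rewrite asboolF ?addr0 // => -[].
  rewrite !ltr_norml => /andP[? ?] /andP[? ?] /andP[? ?].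
  by rewrite ler_norml; apply/andP; split; lra.
move=> g; have : gen_set [set` s] g by rewrite s_gen.
move=> /(_ [set g | forall A, M [set (g * x)%g | x in A] = M A]); apply.
split; last by move=> h /= hs A; apply: inv1.
have imageM h k (A : set G) : [set (h * k * x)%g | x in A] =
    [set (h * y)%g | y in [set (k * x)%g | x in A]].
  apply/seteqP; split=> _ [x Ax <-]; first by exists (k * x)%g; [exists x|rewrite mulgA].
  by case: Ax => y Ay <-; exists y; rewrite ?mulgA.
have image1 (A : set G) : [set (1 * x)%g | x in A] = A.
  by apply/seteqP; split=> [_ [x Ax <-]|x Ax]; [rewrite mul1g|exists x; rewrite ?mul1g].
split=> [A|h k Mh Mk A|h Mh A]; first by rewrite image1.
- by rewrite imageM Mh Mk.
- by rewrite -[LHS]Mh -imageM mulgV image1.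
Qed.

End Amenability.

Section LocalAmenable.
Context (R : realType) (A : Type) (w : int -> A) (lin : linear_complexity w).
Context (S : set zperm) (S_loc : forall g, gen_set S g -> locperm w g).

(** The uniform measure on a symmetric generating set containing 1. *)
Theorem local_amenable : finitely_generated (generated S) ->
  amenable R (generated S).
Proof.
move=> [S0 /finite_seqP[l ->] genl]; pose H := generated S.
pose s : seq H := undup (1%g :: l ++ map (fun g => (g^-1)%g) l).
have us : uniq s by apply: undup_uniq.
have s1 : 1%g \in s by rewrite mem_undup mem_head.
have sV g : g \in s -> (g^-1)%g \in s.
  rewrite !mem_undup !inE !mem_cat => /predU1P[->|]; first by rewrite invg1 eqxx.
  move=> /orP[gl|/mapP[h hl ->]]; apply/orP; right; apply/orP.
    by right; apply: map_f.
  by left; rewrite invgK.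
have size0 : (0 < size s)%N by case: (s) s1.
pose mu (g : H) : R := (size s)%:R^-1.
have mu_gt0 g : g \in s -> 0 < mu g by rewrite invr_gt0 ltr0n.
have mu1 : \sum_(g <- s) mu g = 1.
  rewrite big_const_seq count_predT iter_addr_0 -[LHS]mulr_natl mulfV //.
  by rewrite pnatr_eq0 -lt0n.
have rho_loc (g : H) : g \in s -> locperm w (val g).
  by move=> _; apply: S_loc; have := valP g; rewrite inE.
have slow := @sublinear_entropy R A w lin H s mu val us mu_gt0 mu1 sV
  (fun=> erefl) erefl (fun _ _ => erefl) val_inj rho_loc.
have mixing := @slow_entropy_mixing R H s mu us mu_gt0 mu1 slow.
apply: (@mixing_amenable R H s mu mu_gt0 mu1 mixing s1).
apply/seteqP; split=> // g _; have : gen_set [set` l] g by rewrite genl.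
apply; split; first exact: gen_set_subgroup.
move=> h hl L [_]; apply; rewrite /= mem_undup inE mem_cat.
by rewrite (hl : h \in l) orbT.
Qed.

End LocalAmenable.

(** * Grigorchuk groups in simple groups with the Liouville property *)

Theorem theorem4p1 (R : realType) (omega : Omega) :
  exists H : groupType,
    [/\ finitely_generated H, simple_group H, embeds_in (grigorchuk omega) H,
        liouville R H & amenable R H].
Proof.
pose w := toeplitz (grig_label omega).
have lin : linear_complexity w := toeplitz_linear (grig_label omega).
have sp : sparse_patterns w := toeplitz_sparse (@grig_label_neq omega).
have rc : recurrent w := toeplitz_recurrent (grig_label omega).
have fg := three_cycles_fg lin sp.
have loc g : gen_set (three_cycles w) g -> locperm w g.
  exact: three_cycles_locperm.
exists (generated (three_cycles w)); split.
- exact: fg.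
- exact: three_cycles_simple.
- exact: grigorchuk_embeds.
- exact (@local_liouville R _ w lin _ loc).
- exact (@local_amenable R _ w lin _ loc fg).
Qed.
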